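(* Let $1<p<\infty$, $0<\lambda<n$, and let $w=|\cdot|^{\alpha}$, i.e. $w(x)=|x|^{\alpha}$, be a power weight on $\mathbb{R}^n$. Then the weighted inequality $$\|Mf\|_{L^{p,\lambda}(w)}\le C\|f\|_{L^{p,\lambda}(w)}$$ holds (for all locally integrable $f\in L^{p,\lambda}(\mathbb{R}^n,w)$, with a constant $C>0$ independent of $f$) if and only if $$\lambda-n\le\alpha<\lambda+(p-1)n.$$
   Context: $\mathcal{Q}$ is the family of all cubes in $\mathbb{R}^n$ with sides parallel to the coordinate axes; $l(Q)$ is the side length and $|Q|$ the volume of $Q$; $1_Q$ is the characteristic function of $Q$. A weight is a non-negative, locally integrable function on $\mathbb{R}^n$ that is positive on a set of positive measure. Thus $|\cdot|^{\alpha}$ being a weight means that $\alpha$ is real with $\alpha>-n$. Hardy-Littlewood maximal operator: for a locally integrable function $f$ on $\mathbb{R}^n$, $$Mf(x)=\sup_{Q\in\mathcal{Q}}\left(\frac{1}{|Q|}\int_Q|f(y)|\,dy\right)1_Q(x).$$ Weighted Morrey space: for a weight $w$, $$\|f\|_{L^{p,\lambda}(w)}=\sup_{Q\in\mathcal{Q}}\left(\frac{1}{l(Q)^{\lambda}}\int_Q|f(x)|^p w(x)\,dx\right)^{1/p},$$ and $L^{p,\lambda}(\mathbb{R}^n,w)$ is the space of functions $f$ with $\|f\|_{L^{p,\lambda}(w)}<\infty$. *)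

(* Defs.v *)
From HB Require Import structures.
From mathcomp Require Import all_boot all_order all_algebra.
From mathcomp Require Import all_classical all_reals all_analysis.

Set Implicit Arguments.
Unset Strict Implicit.
Unset Printing Implicit Defensive.

Import Order.TTheory GRing.Theory Num.Theory.
Import numFieldNormedType.Exports.

Local Open Scope classical_set_scope.
Local Open Scope ring_scope.
Local Open Scope ereal_scope.

Section cons_measure.
Context d (T : measurableType d) (R : realType) (n : nat).
Variable m1 : {sigma_finite_measure set T -> \bar R}.
Variable m2 : {sigma_finite_measure set (n.-tuple T) -> \bar R}.

Definition cons_pair (xy : T * n.-tuple T) : n.+1.-tuple T :=
  [the n.+1.-tuple T of xy.1 :: xy.2].

Lemma measurable_cons_pair : measurable_fun [set: T * n.-tuple T] cons_pair.
Proof. exact: measurable_cons. Qed.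

Definition cons_measure : set (n.+1.-tuple T) -> \bar R :=
  pushforward (m1 \x m2) cons_pair.

Let cons_measure0 : cons_measure set0 = 0.
Proof. by rewrite /cons_measure /pushforward preimage_set0 measure0. Qed.

Let cons_measure_ge0 A : 0 <= cons_measure A.
Proof. by rewrite /cons_measure /pushforward. Qed.

Let cons_measure_sigma_additive : semi_sigma_additive cons_measure.
Proof.
by have := @measure_semi_sigma_additive _ _ _
  (@Measure.clone _ _ _ (pushforward (m1 \x m2) cons_pair)
     (measure_function_pushforward__canonical__measure_function_Measure
       _ measurable_cons_pair)).
Qed.

HB.instance Definition _ := isMeasure.Build _ _ _ cons_measure
  cons_measure0 cons_measure_ge0 cons_measure_sigma_additive.

Let cons_measure_sigma_finite : sigma_finite setT cons_measure.
Proof.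
have /sigma_finiteP[F [FT ndF Foo]] := sigma_finiteT m1.
have /sigma_finiteP[G [GT ndG Goo]] := sigma_finiteT m2.
pose g (t : n.+1.-tuple T) := (thead t, [tuple of behead t]).
have gK : cancel cons_pair g.
  by move=> [x t]; rewrite /g /cons_pair/= theadE; congr pair; exact/val_inj.
have mg : measurable_fun [set: n.+1.-tuple T] g.
  apply: measurable_fun_pair; first exact: measurable_tnth.
  exact: measurable_behead.
exists (fun k => g @^-1` (F k `*` G k)).
  apply/esym; rewrite -subTset => t _.
  have [i _ Fi] : (\bigcup_k F k) (g t).1 by rewrite -FT.
  have [j _ Gj] : (\bigcup_k G k) (g t).2 by rewrite -GT.
  exists (maxn i j) => //; split.
  - by move: Fi; exact/subsetPset/ndF/leq_maxl.
  - by move: Gj; exact/subsetPset/ndG/leq_maxr.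
move=> k; have [mF Fk] := Foo k; have [mG Gk] := Goo k; split.
  by rewrite -[X in measurable X]setTI; apply: mg => //; exact: measurableX.
rewrite /cons_measure /pushforward -comp_preimage.
rewrite (_ : g \o cons_pair = id) ?preimage_id; last exact/funext.
by rewrite product_measure1E// lte_mul_pinfty// ge0_fin_numE.
Qed.

HB.instance Definition _ := Measure_isSigmaFinite.Build _ _ _ cons_measure
  cons_measure_sigma_finite.
End cons_measure.

(* Lebesgue measure on the Borel sets of R^n, as the n-fold product of the
   one-dimensional Lebesgue measure. *)
Fixpoint borel_lebesgue (R : realType) (n : nat) :
    {sigma_finite_measure set (n.-tuple (measurableTypeR R)) -> \bar R} :=
  match n with
  | 0%N => \d_([tuple] : 0.-tuple (measurableTypeR R))
  | n'.+1 => cons_measure (@lebesgue_measure R) (borel_lebesgue R n')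
  end.

Lemma measurable_box d (T : measurableType d) n (A : 'I_n -> set T) :
  (forall i, measurable (A i)) ->
  measurable [set x : n.-tuple T | forall i, A i (tnth x i)].
Proof.
move=> mA.
rewrite (_ : mkset _ = \bigcap_(i in [set: 'I_n])
    ((fun x : n.-tuple T => tnth x i) @^-1` A i)); last first.
  by apply/seteqP; split => [x xA i _|x xA i]; exact: xA.
apply: fin_bigcap_measurable => // i _; rewrite -[X in measurable X]setTI.
exact: measurable_tnth.
Qed.

Lemma borel_lebesgue_box (R : realType) n
    (A : 'I_n -> set (measurableTypeR R)) :
  (forall i, measurable (A i)) ->
  borel_lebesgue R n [set x | forall i, A i (tnth x i)] =
  \prod_(i < n) lebesgue_measure (A i).
Proof.
elim: n => [|n IHn] in A *.
  by move=> _; rewrite big_ord0 /= /dirac indicE mem_set// => -[].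
move=> mA; rewrite big_ord_recl -IHn//.
pose B : set (n.-tuple (measurableTypeR R)) :=
  [set x | forall i, A (lift ord0 i) (tnth x i)].
have mB : measurable B by exact: (measurable_box (fun i => mA (lift ord0 i))).
rewrite -(product_measure1E lebesgue_measure (borel_lebesgue R n) (mA ord0) mB).
rewrite /= /cons_measure /pushforward; congr product_measure1.
apply/seteqP; split => [[x t]/= xtA|[x t]/= [xA tA] i].
  split; first exact: (xtA ord0).
  by move=> i; have := xtA (lift ord0 i); rewrite tnthS.
by case: (unliftP ord0 i) => [j|] ->; rewrite ?tnthS//; exact: tA.
Qed.

Definition outer_lebesgue (R : realType) (n : nat) :
    {outer_measure set (n.-tuple (measurableTypeR R)) -> \bar R} :=
  [the {outer_measure set _ -> \bar R} of (borel_lebesgue R n)^*%mu].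

(* R^n with the sigma-algebra of all Lebesgue measurable sets, obtained from
   Caratheodory's criterion for the Lebesgue outer measure; points are
   n-tuples and their coordinates are read with [tnth]. *)
Definition Rn (R : realType) (n : nat) : Type :=
  caratheodory_type (outer_lebesgue R n).

HB.instance Definition _ (R : realType) (n : nat) := Measurable.on (Rn R n).

Definition lebesgue_Rn {R : realType} {n : nat} : set (Rn R n) -> \bar R :=
  outer_lebesgue R n.

Lemma lebesgue_Rn0 (R : realType) (n : nat) : @lebesgue_Rn R n set0 = 0.
Proof. exact: outer_measure0. Qed.

Lemma lebesgue_Rn_ge0 (R : realType) (n : nat) (A : set (Rn R n)) :
  0 <= lebesgue_Rn A.
Proof. exact: outer_measure_ge0. Qed.

Lemma lebesgue_Rn_sigma_additive (R : realType) (n : nat) :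
  semi_sigma_additive (@lebesgue_Rn R n).
Proof.
move=> F mF tF mUF.
exact: (@caratheodory_measure_sigma_additive _ _ (outer_lebesgue R n)).
Qed.

HB.instance Definition _ (R : realType) (n : nat) :=
  isMeasure.Build _ _ _ (@lebesgue_Rn R n) (@lebesgue_Rn0 R n)
    (@lebesgue_Rn_ge0 R n) (@lebesgue_Rn_sigma_additive R n).

Lemma lebesgue_Rn_sigma_finite (R : realType) (n : nat) :
  sigma_finite setT (@lebesgue_Rn R n).
Proof. exact/completed_measure_extension_sigma_finite/sigma_finiteT. Qed.

HB.instance Definition _ (R : realType) (n : nat) :=
  Measure_isSigmaFinite.Build _ _ _ (@lebesgue_Rn R n)
    (@lebesgue_Rn_sigma_finite R n).

Lemma measurable_Rn (R : realType) n (A : set (n.-tuple (measurableTypeR R))) :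
  measurable A -> measurable (A : set (Rn R n)).
Proof. by move=> mA; exact: caratheodory_measurable_mu_ext. Qed.

Lemma lebesgue_RnE (R : realType) n (A : set (n.-tuple (measurableTypeR R))) :
  measurable A -> lebesgue_Rn (A : set (Rn R n)) = borel_lebesgue R n A.
Proof. by move=> mA; exact: measurable_mu_extE. Qed.

Section morrey.
Context {R : realType} {n : nat}.
Implicit Types (a x : Rn R n) (l p lambda alpha : R).
Implicit Types (f w : Rn R n -> R) (g : Rn R n -> \bar R).

Local Notation mu := (@lebesgue_Rn R n).

(* Closed cubes; open or half-open ones would give the same maximal function
   of a locally integrable function and the same Morrey norms. *)
Definition cube a l : set (Rn R n) :=
  [set x | forall i : 'I_n, tnth x i \in `[tnth a i, (tnth a i + l)%R]].

Definition locally_integrable_Rn f :=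
  measurable_fun setT f /\
  forall a l, (0 < l)%R -> \int[mu]_(x in cube a l) `|f x|%:E < +oo.

Definition weight w :=
  [/\ forall x, (0 <= w x)%R, locally_integrable_Rn w &
      0 < mu [set x | (0 < w x)%R]].

Definition maximal f x : \bar R :=
  ereal_sup [set ((mu (cube a l))^-1 * (\int[mu]_(y in cube a l) `|f y|%:E))
                   * (\1_(cube a l) x)%:E
            | a in setT & l in [set l | (0 < l)%R]].

Definition morrey_norm p lambda w g : \bar R :=
  ereal_sup [set ((l `^ lambda)^-1%R%:E *
                  \int[mu]_(x in cube a l) (`|g x| `^ p * (w x)%:E)) `^ p^-1
            | a in setT & l in [set l | (0 < l)%R]].

Definition euclidean_norm x : R := Num.sqrt (\sum_(i < n) tnth x i ^+ 2)%R.

(* Since [powR] is total, this is 0 at the origin when [alpha < 0]; this is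
   immaterial, as a single point is negligible for n >= 1. *)
Definition power_weight alpha x : R := (euclidean_norm x `^ alpha)%R.

End morrey.

Lemma measurable_cube (R : realType) n (a : Rn R n) l :
  measurable (cube a l).
Proof.
apply: measurable_Rn.
by apply: (@measurable_box _ _ n
  (fun i => [set` `[tnth a i, tnth a i + l]%R])) => i.
Qed.

Lemma lebesgue_Rn_cube (R : realType) n (a : Rn R n) l : (0 <= l)%R ->
  lebesgue_Rn (cube a l) = (l ^+ n)%:E.
Proof.
move=> l0.
pose A i : set (measurableTypeR R) := [set` `[tnth a i, tnth a i + l]%R].
have mA i : measurable (A i) by exact: measurable_itv.
rewrite (lebesgue_RnE (measurable_box mA)) borel_lebesgue_box//.
rewrite (eq_bigr (fun=> l%:E)) => [|i _].
  by rewrite prodEFin prodr_const card_ord.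
rewrite lebesgue_measure_itv/= lte_fin ltrDl -EFinD addrC addKr.
by move: l0; rewrite le_eqVlt => /predU1P[<-|->//]; rewrite ltxx.
Qed.

(* Main.v *)
Require Import Defs.
From mathcomp Require Import all_boot all_order all_algebra.
From mathcomp Require Import all_classical all_reals all_analysis.
From mathcomp Require Import measurable_realfun ring lra.
Import Order.TTheory GRing.Theory Num.Theory.
Import numFieldNormedType.Exports.
Local Open Scope classical_set_scope.
Local Open Scope ring_scope.

Set Implicit Arguments.
Unset Strict Implicit.
Unset Printing Implicit Defensive.

(* Sufficiency.  On a shell {D/4 < |x| <= 4D} the weight is comparable to the
   constant D^alpha.  Let A be a subset of the shell around |x| = D, and let
   s <= D/8.  Averages of |f| over cubes of side at least s meeting A are
   bounded by tau = C b D^(-alpha/p) s^((lambda-n)/p), b being the Morrey norm of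
   f: directly when the cube stays in the shell, and otherwise by summing |f|
   over dyadic shells around the origin, a geometric series which converges since
   alpha < lambda + (p-1)n; the passage back to the scale s uses
   alpha >= lambda - n.  Hence above the level tau only cubes of side less than s
   matter, and the unweighted maximal theorem, localized and started at the level
   tau, gives int_A (Mf)^p w <= C b^p s^lambda.  A cube far from the origin is such
   a set A; a cube close to it is covered by shells, and these estimates sum
   geometrically since lambda > 0.

   Necessity.  The test functions are sums of N disjoint bumps of height
   2^(-k beta), beta = (lambda-alpha-n)/p, on cubes of side 2^(-k-1) at distance
   2^(-k) from the origin; their Morrey norm to the power p is O(N).  For N = 1,
   small cubes at the origin force alpha >= lambda - n.  If
   alpha >= lambda + (p-1)n, the maximal function is at least cN near the origin,
   so N^p = O(N), which is absurd. *)

(** * Cubes and Vitali coverings *)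

Section cubes.
Context {R : realType} {n : nat}.
Implicit Types (a x y : Rn R n) (l r : R).
Local Notation mu := (@lebesgue_Rn R n).

Lemma cubeP a l x :
  cube a l x <-> forall i, tnth a i <= tnth x i <= tnth a i + l.
Proof. by split=> h i; have := h i; rewrite in_itv. Qed.

Lemma cube_refl a l : 0 <= l -> cube a l a.
Proof. by move=> l0; apply/cubeP => i; rewrite lexx lerDl. Qed.

(** Diagonal points: [diag 0] serves as the origin, and the others as corners of cubes placed
    symmetrically or along the diagonal. *)
Definition diag r : Rn R n := [tuple r | i < n].

Lemma tnth_diag r i : tnth (diag r) i = r.
Proof. exact: tnth_mktuple. Qed.

(** The closed ball of radius r around the origin for the sup norm, encoded as a cube so that
    measurability and volume are inherited. *)
Definition cball r : set (Rn R n) := cube (diag (- r)) (2 * r).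

Lemma cballP r x : cball r x <-> forall i, `|tnth x i| <= r.
Proof.
rewrite /cball; split=> [/cubeP h i|h]; last apply/cubeP => i.
  by have := h i; rewrite tnth_diag ler_norml; lra.
by have := h i; rewrite tnth_diag ler_norml; lra.
Qed.

Lemma measurable_cball r : measurable (cball r).
Proof. exact: measurable_cube. Qed.

Lemma le_cball r1 r2 : r1 <= r2 -> cball r1 `<=` cball r2.
Proof. by move=> r12 x /cballP h; apply/cballP => i; exact: le_trans (h i) _. Qed.

Lemma not_cballP r x : ~ cball r x <-> exists i, r < `|tnth x i|.
Proof.
split=> [/cballP/existsNP[i /negP]|[i ri] /cballP/(_ i)]; last by rewrite leNgt ri.
by rewrite -ltNge => ri; exists i.
Qed.

Lemma cube_dist a l x y i : cube a l x -> cube a l y ->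
  `|tnth x i - tnth y i| <= l.
Proof.
move=> /cubeP/(_ i) hx /cubeP/(_ i) hy.
by rewrite ler_norml; lra.
Qed.

Lemma cube_set1 (a : Rn R n) : cube a 0 = [set a].
Proof.
apply/seteqP; split => [x /cubeP h|x ->]; last exact: cube_refl.
apply: eq_from_tnth => i; have := h i.
by rewrite addr0 -eq_le eq_sym => /eqP.
Qed.

Lemma le_integral_set (f g : Rn R n -> \bar R) (A : set (Rn R n)) :
  measurable A -> measurable_fun setT f -> measurable_fun setT g ->
  (forall x, 0 <= f x)%E -> (forall x, A x -> f x <= g x)%E ->
  (\int[mu]_(x in A) f x <= \int[mu]_(x in A) g x)%E.
Proof.
move=> mA mf mg f0 fg; apply: ge0_le_integral.
- exact: mA.
- by move=> x _; exact: f0.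
- exact: measurable_funTS mf.
- exact: measurable_funTS mg.
- exact: fg.
Qed.

Lemma subset_integral_set (f : Rn R n -> \bar R) (A B : set (Rn R n)) :
  measurable A -> measurable B -> measurable_fun setT f ->
  (forall x, 0 <= f x)%E -> A `<=` B ->
  (\int[mu]_(x in A) f x <= \int[mu]_(x in B) f x)%E.
Proof.
move=> mA mB mf f0.
apply: ge0_subset_integral.
- exact: mA.
- exact: mB.
- exact: measurable_funTS mf.
- by move=> x _; exact: f0.
Qed.

Lemma integral_cst_cube a l k : 0 <= l ->
  (\int[mu]_(x in cube a l) k%:E = (k * l ^+ n)%:E)%E.
Proof.
move=> l0; rewrite (integral_cst _ (measurable_cube a l)) EFinM.
by congr (_ * _)%E; exact: lebesgue_Rn_cube.
Qed.

(** Geometric input of the covering argument: the cube on the right is the concentric triple of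
    [cube a l]. *)
Lemma cube_triple a b l m : m <= l -> cube a l `&` cube b m !=set0 ->
  cube b m `<=` cube [tuple tnth a i - l | i < n] (3 * l).
Proof.
move=> ml [z [/cubeP za /cubeP zb]] x /cubeP xb.
apply/cubeP => i; rewrite tnth_mktuple.
by have := za i; have := zb i; have := xb i; lra.
Qed.

End cubes.

Section vitali.
Context {R : realType} {n : nat}.
Local Notation mu := (@lebesgue_Rn R n).
Variables (c : nat -> Rn R n) (l : nat -> R) (h : Rn R n -> \bar R) (t : R).
Hypotheses (l_gt0 : forall i, 0 < l i) (t_gt0 : 0 < t).
Hypotheses (mh : measurable_fun setT h) (h_ge0 : forall x, (0 <= h x)%E).

Local Notation Q := (fun i => cube (c i) (l i)).

Lemma seq_argmax (s : seq nat) : s != [::] ->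
  exists2 i, i \in s & forall j, j \in s -> l j <= l i.
Proof.
elim: s => // k s IH _; have [->|/IH[i si imax]] := eqVneq s [::].
  by exists k => [|j]; rewrite ?mem_head// mem_seq1 => /eqP->.
have [lik|lki] := leP (l i) (l k).
  exists k; first exact: mem_head.
  move=> j; rewrite inE => /predU1P[->//|/imax/le_trans]; exact.
exists i; first by rewrite inE si orbT.
by move=> j; rewrite inE => /predU1P[->|/imax//]; exact: ltW.
Qed.

(* The finite Vitali covering argument: keep a largest cube, discard all the
   cubes meeting it (its triple covers them), and recurse. *)
Lemma vitali_seq (s : seq nat) :
  (forall i, i \in s -> ((t * l i ^+ n)%:E <= \int[mu]_(x in Q i) h x)%E) ->
  (mu (\bigcup_(i in [set` s]) Q i) <=
     (3 ^+ n / t)%:E * \int[mu]_(x in \bigcup_(i in [set` s]) Q i) h x)%E.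
Proof.
have mQ i : measurable (Q i) by exact: measurable_cube.
have mU (r : seq nat) : measurable (\bigcup_(i in [set` r]) Q i).
  by rewrite bigcup_seq; exact: bigsetU_measurable.
have [k] := ubnP (size s); elim: k => // k IH in s *; rewrite ltnS => sk hs.
have [->|s0] := eqVneq s [::].
  rewrite (_ : [set` [::]] = set0); last by apply/seteqP; split.
  by rewrite bigcup_set0 measure0 integral_set0 mule0.
have [i si imax] := seq_argmax s0.
pose s' := [seq j <- s | `[< Q i `&` Q j = set0 >]].
have s's j : j \in s' -> j \in s by rewrite mem_filter => /andP[].
have Qi0 : Q i (c i) by apply: cube_refl; exact: ltW.
(* The index i itself is discarded, since Q i contains its corner and so meets itself. *)
have s'k : (size s' < k)%N.
  rewrite (leq_trans _ sk)// size_filter ltn_neqAle count_size andbT.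
  rewrite -all_count; apply/negP => /allP/(_ _ si)/asboolP.
  by rewrite setIid => Q0; move: Qi0; rewrite Q0.
have {IH} IH := IH s' s'k (fun j js => hs j (s's j js)).
set U := \bigcup_(j in [set` s]) Q j.
set U' := \bigcup_(j in [set` s']) Q j in IH.
pose T : set (Rn R n) := cube [tuple tnth (c i) j - l i | j < n] (3 * l i).
have UT : U `<=` T `|` U'.
  move=> x [j /= js Qjx]; have [ij|/set0P ij] := eqVneq (Q i `&` Q j) set0.
    by right; exists j => //=; rewrite mem_filter js andbT; exact/asboolP.
  by left; apply: (cube_triple (imax _ js) ij).
have muT : mu T = (3 ^+ n * l i ^+ n)%:E.
  by rewrite lebesgue_Rn_cube ?exprMn// mulr_ge0// ltW.
have mT : measurable T by exact: measurable_cube.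
apply: (@le_trans _ _ (mu T + mu U')%E).
  apply: (le_trans (le_measure mu _ _ UT)); rewrite ?inE; first exact: mU.
    by apply: measurableU => //; exact: mU.
  by apply: measureU2 => //; exact: mU.
(* The retained cubes avoid Q i, so the integral over this union splits: the part over Q i pays for
   the triple [T], the part over [U'] for the rest by induction. *)
apply: (@le_trans _ _ ((3 ^+ n / t)%:E * \int[mu]_(x in Q i `|` U') h x)%E); last first.
  apply: lee_wpmul2l; first by rewrite lee_fin divr_ge0 ?exprn_ge0// ltW.
  apply: ge0_subset_integral => //; first by apply: measurableU => //; exact: mU.
  - exact: mU.
  - exact: measurable_funTS.
  - move=> x [Qix|[j /= /s's js Qjx]]; first by exists i.
      by exists j.
rewrite ge0_integral_setU//; last 3 first.
- exact: mU.
- exact: measurable_funTS.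
- rewrite disj_set2E; apply/eqP/seteqP; split => // x [Qix [j /=]].
  rewrite mem_filter => /andP[/asboolP ij _] Qjx.
  suff : (Q i `&` Q j) x by rewrite ij.
  by [].
rewrite ge0_muleDr ?integral_ge0//; apply: leeD => //.
have -> : mu T = ((3 ^+ n / t)%:E * (t * l i ^+ n)%:E)%E.
  by rewrite muT -EFinM; congr EFin; field; rewrite gt_eqF.
apply: lee_wpmul2l; last exact: hs.
by rewrite lee_fin divr_ge0 ?exprn_ge0// ltW.
Qed.

(** Continuity of the measure from below reduces this to the finite families of indices of [D] below
    N; the bound is uniform in N because all the cubes lie in [A]. *)
Lemma vitali_countable (D : set nat) (A : set (Rn R n)) :
  (forall i, D i -> ((t * l i ^+ n)%:E <= \int[mu]_(x in Q i) h x)%E) ->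
  measurable A -> (forall i, D i -> Q i `<=` A) ->
  (mu (\bigcup_(i in D) Q i) <= (3 ^+ n / t)%:E * \int[mu]_(x in A) h x)%E.
Proof.
move=> hD mA DA.
have mQ i : measurable (Q i) by exact: measurable_cube.
pose s N := [seq i <- iota 0 N | `[< D i >]].
pose F N := \bigcup_(i in [set` s N]) Q i.
have sP N i : [set` s N] i <-> (i < N)%N /\ D i.
  rewrite /= mem_filter mem_iota /= add0n andbC.
  by split => [/andP[-> /asboolP]|[-> /asboolP->]].
have mF N : measurable (F N) by rewrite /F bigcup_seq; exact: bigsetU_measurable.
have FE : \bigcup_(i in D) Q i = \bigcup_N F N.
  apply/seteqP; split => [x [i Di Qx]|x [N _ [i /sP[_ Di] Qx]]]; last by exists i.
  by exists i.+1 => //; exists i => //; apply/sP.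
have ndF : nondecreasing_seq F.
  move=> N M NM; apply/subsetPset => x [i /sP[iN Di] Qx]; exists i => //.
  by apply/sP; split=> //; exact: leq_trans NM.
have mUF : measurable (\bigcup_N F N) by exact: bigcup_measurable.
rewrite FE -(cvg_lim _ (nondecreasing_cvg_mu (mu := mu) mF mUF ndF))//.
apply: lime_le.
  apply: ereal_nondecreasing_is_cvgn => N M /ndF/subsetPset NM.
  by apply: le_measure; rewrite ?inE.
apply: nearW => N; apply: (le_trans (vitali_seq _)).
  by move=> i si; apply: hD; apply (sP N i).
apply: lee_wpmul2l; first by rewrite lee_fin divr_ge0 ?exprn_ge0// ltW.
apply: ge0_subset_integral => //; [exact: mF|exact: measurable_funTS|].
by move=> x [i /sP[_ /DA]]; exact.
Qed.

End vitali.

(** * The maximal inequality in L^p *)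

Section maximal_function.
Context {R : realType} {n : nat}.
Local Notation mu := (@lebesgue_Rn R n).
Implicit Types (a x : Rn R n) (l t : R) (f : Rn R n -> R).

(** An enumeration of the cubes with rational corner and side. The default side 1, for codes of no
    cube or of a nonpositive side, keeps every side positive. *)
Definition rational_cube (i : nat) : Rn R n * R :=
  if unpickle i is Some q then
    ([tuple ratr (tnth (q : n.-tuple rat * rat).1 j) | j < n],
     if 0 < q.2 then ratr q.2 else 1)
  else (diag 0, 1).

Lemma rational_cube_gt0 i : 0 < (rational_cube i).2.
Proof.
rewrite /rational_cube; case: unpickle => //= q.
by case: ifPn => // q0; rewrite ltr0q.
Qed.

(** Each coordinate of the corner is lowered by less than e/3, and a side between l + e/3 and l + e
    makes up for it. *)
Lemma rational_cube_approx a l e : 0 < l -> 0 < e ->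
  exists2 i, (rational_cube i).2 <= l + e &
    cube a l `<=` cube (rational_cube i).1 (rational_cube i).2.
Proof.
move=> l0 e0; have e3 : 0 < e / 3 by rewrite divr_gt0.
have /choice[q hq] : forall i : 'I_n, exists q : rat, ratr q \in `]tnth a i - e / 3, tnth a i[.
  by move=> i; apply: rat_in_itvoo; rewrite ltrBlDr ltrDl.
have [s] : exists s : rat, ratr s \in `]l + e / 3, l + e[.
  by apply: rat_in_itvoo; lra.
rewrite in_itv/= => /andP[ls se].
have s0 : 0 < s by rewrite -(ltr0q R); lra.
exists (pickle ([tuple q i | i < n], s)); rewrite /rational_cube pickleK/= s0.
  exact: ltW.
move=> x /cubeP h; apply/cubeP => i; rewrite !tnth_mktuple.
by have := h i; have := hq i; rewrite in_itv/=; lra.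
Qed.

(** For t >= 0 a cube missing x cannot witness the inequality, as its indicator contributes 0. The
    average is multiplied out to avoid dividing by the volume. *)
Lemma gt_maximalP f x t : 0 <= t ->
  (t%:E < maximal f x)%E <-> exists a l, [/\ 0 < l, cube a l x &
    ((t * l ^+ n)%:E < \int[mu]_(y in cube a l) `|f y|%:E)%E].
Proof.
move=> t0.
have ltE a l : 0 < l -> ((t * l ^+ n)%:E < \int[mu]_(y in cube a l) `|f y|%:E)%E =
    (t%:E < (mu (cube a l))^-1 * \int[mu]_(y in cube a l) `|f y|%:E)%E.
  move=> l0; have ln0 : 0 < l ^+ n by rewrite exprn_gt0.
  by rewrite lebesgue_Rn_cube ?ltW// inver gt_eqF// lte_pdivlMl// -EFinM mulrC.
split=> [/ereal_sup_gt[_ [a _ [l /= l0 <-]]]|[a [l [l0 xal]]]].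
  rewrite indicE; case: (boolP (x \in _)) => [|_]; last first.
    by rewrite mule0 lte_fin ltNge t0.
  by rewrite mule1 -ltE// inE; exists a, l.
rewrite ltE// => /lt_le_trans; apply; apply: ereal_sup_ubound.
by exists a => //; exists l => //; rewrite indicE mem_set// mule1.
Qed.

Lemma maximal_ge0 f x : (0 <= maximal f x)%E.
Proof.
apply: (@le_trans _ _ ((mu (cube x 1))^-1 *
  (\int[mu]_(y in cube x 1) `|f y|%:E) * (\1_(cube x 1) x)%:E)%E).
  rewrite !mule_ge0 ?inve_ge0 ?lee_fin//.
  by apply: integral_ge0 => y _; rewrite lee_fin.
by apply: ereal_sup_ubound => /=; exists x => //; exists 1 => //=; exact: ltr01.
Qed.

Variable f : Rn R n -> R.
Hypothesis lf : locally_integrable_Rn f.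

Let mf : measurable_fun setT f := lf.1.

Let mnormf : measurable_fun setT (fun x => `|f x|).
Proof. exact: measurableT_comp. Qed.

Let mabsf : measurable_fun setT (fun x => `|f x|%:E).
Proof. exact/measurable_EFinP. Qed.

(* A cube with average above [t] sits in a rational cube with the same
   property, by continuity of [l |-> t * l ^+ n]. *)
Lemma gt_maximal_bigcup t : 0 <= t ->
  [set x | (t%:E < maximal f x)%E] = \bigcup_(i in [set i |
    ((t * (rational_cube i).2 ^+ n)%:E <
      \int[mu]_(x in cube (rational_cube i).1 (rational_cube i).2) `|f x|%:E)%E])
    cube (rational_cube i).1 (rational_cube i).2.
Proof.
move=> t0; apply/seteqP; split => [x|x [i /= ti xi]]; last first.
  apply/(gt_maximalP _ _ t0); exists (rational_cube i).1, (rational_cube i).2.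
  by split => //; exact: rational_cube_gt0.
move/(gt_maximalP _ _ t0) => [a [l [l0 xal]]].
set I := (X in (_ < X)%E) => tI.
have Ifin : I \is a fin_num.
  by rewrite ge0_fin_numE ?integral_ge0//; apply lf.2.
have [e e0 he] : exists2 e, 0 < e & t * (l + e) ^+ n < fine I.
  have : (t * (l + e) ^+ n) @[e --> 0^'+] --> (t * (l + 0) ^+ n).
    apply: cvg_at_right_filter; apply: cvgMr.
    apply: (@continuous_comp _ _ _ (fun e => l + e) (fun x : R => x ^+ n)).
      by apply: cvgD; [exact: cvg_cst|exact: cvg_id].
    exact: exprn_continuous.
  rewrite addr0 => /cvgr_lt/(_ (fine I)).
  rewrite -lte_fin fineK// => /(_ tI) h.
  near (0 : R)^'+ => e; exists e => //.
  by near: e.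
have [i si ali] := rational_cube_approx a l0 e0.
have i0 := rational_cube_gt0 i.
exists i; last exact: ali.
rewrite /= (@lt_le_trans _ _ I)//.
  rewrite -(fineK Ifin) lte_fin (le_lt_trans _ he)// ler_wpM2l//.
  by rewrite lerXn2r ?nnegrE ?addr_ge0// ltW.
apply: subset_integral_set ali => //; exact: measurable_cube.
Unshelve. all: by end_near. Qed.

Lemma measurable_maximal : measurable_fun setT (maximal f).
Proof.
apply: (measurability _ (ErealGenOInfty.measurableE R)) => _ [_ [t ->]] <-.
rewrite setTI; have [t0|t0] := ltP t 0.
  rewrite (_ : _ @^-1` _ = setT); first exact: measurableT.
  apply/seteqP; split => // x _; rewrite /= in_itv/= andbT.
  by rewrite (lt_le_trans _ (maximal_ge0 f x))// lte_fin.
rewrite (_ : _ @^-1` _ = [set x | (t%:E < maximal f x)%E]); last first.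
  by apply/seteqP; split => x; rewrite /= in_itv/= andbT.
rewrite gt_maximal_bigcup//.
by apply: bigcup_measurable => i _; exact: measurable_cube.
Qed.

(** Values of |f| up to t/2 account for at most half of t l^n, so the part of |f| above t/2 still
    has average at least t/2 on each selected cube, and the covering lemma applies at level t/2. The
    set [B] localizes: it contains every cube that matters for [A]. *)
Lemma weak_type_maximal (A B : set (Rn R n)) t : 0 < t -> measurable B ->
  (forall a l, 0 < l -> cube a l `&` A !=set0 ->
    ((t * l ^+ n)%:E < \int[mu]_(y in cube a l) `|f y|%:E)%E ->
    cube a l `<=` B) ->
  measurable A ->
  (mu (A `&` [set x | t%:E < maximal f x]) <=
    (3 ^+ n * 2 / t)%:E * \int[mu]_(x in B)
      (`|f x| * \1_[set x | (t / 2 < `|f x|)%R] x)%:E)%E.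
Proof.
move=> t0 mB AB mA.
have th0 : 0 < t / 2 by rewrite divr_gt0.
pose c i := (rational_cube i).1; pose l i := (rational_cube i).2.
have l0 i : 0 < l i by exact: rational_cube_gt0.
pose D := [set i | ((t * l i ^+ n)%:E < \int[mu]_(x in cube (c i) (l i)) `|f x|%:E)%E
  /\ cube (c i) (l i) `&` A !=set0].
set g := (fun x => _%:E).
have mg : measurable_fun setT g.
  apply/measurable_EFinP; apply: measurable_funM; first exact: mnormf.
  apply: measurable_indic; rewrite -[X in measurable X]setTI.
  exact: measurable_fun_ltr.
have g0 x : (0 <= g x)%E by rewrite lee_fin mulr_ge0.
have mQ i : measurable (cube (c i) (l i)) by exact: measurable_cube.
apply: (@le_trans _ _ (mu (\bigcup_(i in D) cube (c i) (l i)))).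
  apply: le_measure; rewrite ?inE.
  - apply: measurableI => //; rewrite gt_maximal_bigcup ?ltW//.
    by apply: bigcup_measurable => i _; exact: measurable_cube.
  - by apply: bigcup_measurable => i _; exact: measurable_cube.
  - rewrite gt_maximal_bigcup ?ltW// => x [Ax [i /= ti xi]].
    by exists i => //; split=> //; exists x.
rewrite (_ : 3 ^+ n * 2 / t = 3 ^+ n / (t / 2)); last by field; rewrite gt_eqF.
apply: vitali_countable => //; last first.
  by move=> i [ti Qi]; apply: AB.
move=> i [ti _].
have := ltW ti.
have -> : t * l i ^+ n = t / 2 * l i ^+ n + t / 2 * l i ^+ n by field.
have fin : (t / 2 * l i ^+ n)%:E \is a fin_num by [].
rewrite EFinD => /le_trans h; rewrite -(@leeD2lE _ (t / 2 * l i ^+ n)%:E)//; apply: h.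
apply: (@le_trans _ _ (\int[mu]_(x in cube (c i) (l i)) ((t / 2)%:E + g x))%E).
  apply: le_integral_set => [||||x _]; first exact: mQ.
  - exact: mabsf.
  - exact: emeasurable_funD (measurable_cst _) mg.
  - by move=> x; rewrite lee_fin.
  - rewrite /g -EFinD lee_fin indicE.
    case: (boolP (x \in _)) => [_|]; first by rewrite mulr1 lerDr ltW.
    by rewrite notin_setE/= mulr0 addr0 => /negP; rewrite -leNgt.
rewrite ge0_integralD//; last 2 first.
- by move=> x _; rewrite lee_fin ltW.
- exact: measurable_funTS.
by rewrite integral_cst_cube// ltW.
Qed.

End maximal_function.

(** * Sums over dyadic levels *)

Section dyadic_levels.
Context {R : realType}.
Implicit Types (p q t y : R) (k N : nat).

(** A geometric sum is comparable to its last term, here the one with the largest 2^k t below y. *)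
Lemma sum_dyadic_le q t y N : 0 < q -> 0 < t -> 0 <= y ->
  \sum_(k < N) (2 ^+ k * t) `^ q * (2 ^+ k * t < y)%R%:R <=
    2 `^ q / (2 `^ q - 1) * y `^ q.
Proof.
move=> q0 t0 y0.
have q1 : 0 < 2 `^ q - 1.
  have : (1 : R) `^ q < 2 `^ q by rewrite gt0_ltr_powR// ?nnegrE ?ltr1n.
  by rewrite powR1 subr_gt0.
pose S N := \sum_(k < N) (2 ^+ k * t) `^ q * (2 ^+ k * t < y)%R%:R.
have pw M : (2 ^+ M.+1 * t) `^ q = 2 `^ q * (2 ^+ M * t) `^ q.
  by rewrite exprS -mulrA powRM// mulr_ge0// ?exprn_ge0// ltW.
(* The first bound, free of y, drives the induction: while 2^N t < y it implies the second, and
   afterwards no further term is added. *)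
suff : S N <= (2 ^+ N * t) `^ q / (2 `^ q - 1) /\
       S N <= 2 `^ q / (2 `^ q - 1) * y `^ q by case.
elim: N => [|N [IH1 IH2]].
  rewrite /S big_ord0; split; first by rewrite divr_ge0 ?powR_ge0// ltW.
  by rewrite mulr_ge0 ?powR_ge0// divr_ge0 ?powR_ge0// ltW.
have IH3 : S N.+1 <= (2 ^+ N.+1 * t) `^ q / (2 `^ q - 1).
  rewrite /S big_ord_recr/= -/(S N) pw.
  apply: (@le_trans _ _ ((2 ^+ N * t) `^ q / (2 `^ q - 1) + (2 ^+ N * t) `^ q)).
    by apply: lerD => //; case: ltP; rewrite ?mulr1// mulr0 powR_ge0.
  rewrite le_eqVlt; apply/orP; left; apply/eqP; field.
  by rewrite gt_eqF.
split=> //.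
have [Ny|yN] := ltP (2 ^+ N * t) y; last first.
  by rewrite /S big_ord_recr/= -/(S N) ltNge yN mulr0 addr0.
rewrite (le_trans IH3)// pw mulrAC.
apply: ler_pM; rewrite ?mulr_ge0 ?invr_ge0 ?powR_ge0 ?(ltW q1)//.
by rewrite ge0_ler_powR ?nnegrE ?(ltW q0) ?(ltW Ny)// mulr_ge0 ?exprn_ge0// ltW.
Qed.

(** A discrete layer-cake bound. If y is finite and above t, the term with 2^k t < y <= 2^(k+1) t
    suffices; if y is infinite, the series has arbitrarily large terms. *)
Lemma le_dyadic_levels p t (y : \bar R) : 1 <= p -> 0 < t -> (0 <= y)%E ->
  (y `^ p <= (t `^ p)%:E +
    \sum_(k <oo) ((2 ^+ k.+1 * t) `^ p)%:E * ((2 ^+ k * t)%:E < y)%E%:R%:E)%E.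
Proof.
move=> p1 t0 y0; have p0 : 0 < p by lra.
pose u k : \bar R := (((2 ^+ k.+1 * t) `^ p)%:E * ((2 ^+ k * t)%:E < y)%E%:R%:E)%E.
have u0 k : (0 <= u k)%E by rewrite mule_ge0 ?lee_fin ?powR_ge0.
pose S : \bar R := (\sum_(k <oo) u k)%E.
rewrite -[X in (_ <= _ + X)%E]/S.
have uS k : ((2 ^+ k * t)%:E < y)%E -> (((2 ^+ k.+1 * t) `^ p)%:E <= S)%E.
  move=> ky; apply: le_trans (nneseries_lim_ge k.+1 _) => //.
  rewrite big_nat_recr//= {2}/u ky mule1 leeDr//.
  exact: sume_ge0.
have [yt|ty] := leP y t%:E.
  rewrite (@le_trans _ _ (t `^ p)%:E)//; last by rewrite leeDl// nneseries_ge0.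
  rewrite -poweR_EFin; apply: gt0_ler_poweR => //; first exact: ltW.
    by rewrite in_itv/= y0 leey.
  by rewrite in_itv/= leey lee_fin ltW.
apply: (@le_trans _ _ S); last by rewrite leeDr// lee_fin powR_ge0.
have expr_big (M : R) : exists k, M < 2 ^+ k * t.
  exists (Num.truncn (M / t)).+1.
  rewrite -ltr_pdivrMr// (lt_trans (truncnS_gt _))// -natrX ltr_nat.
  exact: ltn_expl.
clearbody S; clear u u0.
case: y y0 ty uS => [r| |]// r0 tr uS; last first.
  rewrite poweRyr ?gt_eqF//.
  suff -> : S = +oo%E by [].
  apply/eqyP => M M0.
  have [k Mk] := expr_big (Num.max 1 M).
  rewrite (@le_trans _ _ ((2 ^+ k.+1 * t) `^ p)%:E)//; last exact/uS/ltry.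
  have k1 : Num.max 1 M <= 2 ^+ k.+1 * t.
    rewrite (le_trans (ltW Mk))// ler_wpM2r ?(ltW t0)// exprS ler_peMl ?exprn_ge0//.
    by rewrite ler1n.
  rewrite lee_fin (@le_trans _ _ (2 ^+ k.+1 * t))//.
    by rewrite (le_trans _ k1)// le_max lexx orbT.
  by apply: le1r_powR => //; rewrite (le_trans _ k1)// le_max lexx.
have ex : exists k, r <= 2 ^+ k * t.
  by have [k /ltW rk] := expr_big r; exists k.
case: (ex_minnP ex) => -[|k] rk kmin.
  by move: tr; rewrite lte_fin; move: rk; rewrite expr0 mul1r leNgt => /negP.
have kr : 2 ^+ k * t < r by rewrite ltNge; apply/negP => /kmin; rewrite ltnn.
apply: le_trans (uS k _); last by rewrite lte_fin.
rewrite poweR_EFin lee_fin ge0_ler_powR ?nnegrE ?(ltW p0)//.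
by rewrite mulr_ge0 ?exprn_ge0// ltW.
Qed.

End dyadic_levels.

(** * The localized strong-type inequality *)

Section strong_type.
Context {R : realType} {n : nat}.
Local Notation mu := (@lebesgue_Rn R n).

Lemma indic_setE (T : Type) (P : T -> bool) x :
  \1_[set x | P x] x = (P x)%:R :> R.
Proof. by rewrite indicE; congr (nat_of_bool _)%:R; apply/idP/idP; rewrite inE. Qed.

(** The factor 3^n 2 is the weak-type constant, 2^p comes from passing from the level 2^k t to
    2^(k+1) t, and the rest from the dyadic sum with exponent p - 1 at 2|f|. *)
Definition strong_constant (p : R) : R :=
  3 ^+ n * 2 * 2 `^ p * (2 `^ (p - 1) / (2 `^ (p - 1) - 1) * 2 `^ (p - 1)).

Lemma strong_constant_ge0 p : 1 <= p -> 0 <= strong_constant p.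
Proof.
move=> p1; rewrite /strong_constant !mulr_ge0 ?exprn_ge0 ?powR_ge0// invr_ge0.
by rewrite subr_ge0 -[leLHS](powRr0 2) ler_powR ?ler1n ?subr_ge0.
Qed.

(** Below the starting level t the trivial bound t^p is used; above it, the weak-type bounds at the
    levels 2^k t are summed. Starting at t is what allows localization to [B]. *)
Lemma strong_type_maximal (f : Rn R n -> R) (A B : set (Rn R n)) p t :
  locally_integrable_Rn f -> 1 < p -> 0 < t ->
  measurable A -> measurable B ->
  (forall a l, 0 < l -> cube a l `&` A !=set0 ->
    ((t * l ^+ n)%:E < \int[mu]_(y in cube a l) `|f y|%:E)%E ->
    cube a l `<=` B) ->
  (\int[mu]_(x in A) maximal f x `^ p <=
    (t `^ p)%:E * mu A + (strong_constant p)%:E * \int[mu]_(x in B) (`|f x| `^ p)%:E)%E.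
Proof.
move=> lf p1 t0 mA mB AB.
have mf : measurable_fun setT f by exact: lf.1.
have mabs : measurable_fun setT (fun x => `|f x|) by exact: measurableT_comp.
have mM := measurable_maximal lf.
have mMp : measurable_fun setT (fun x => maximal f x `^ p)%E.
  exact: (measurableT_comp (measurable_poweR p) mM).
have tk k : 0 < 2 ^+ k * t by rewrite mulr_gt0 ?exprn_gt0.
pose E k := [set x | ((2 ^+ k * t)%:E < maximal f x)%E].
have mE k : measurable (E k).
  by rewrite -[X in measurable X]setTI; apply: emeasurable_fun_o_infty.
pose u k x := (((2 ^+ k.+1 * t) `^ p)%:E * (\1_(E k) x)%:E)%E.
have mu_ k : measurable_fun setT (u k).
  by apply: measurable_funeM; apply/measurable_EFinP; exact: measurable_indic.
have u0 k x : (0 <= u k x)%E by rewrite mule_ge0 ?lee_fin ?powR_ge0.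
have mS : measurable_fun setT (fun x => \sum_(k <oo) u k x)%E.
  by apply: ge0_emeasurable_sum => k *; [exact: u0|exact: mu_].
apply: (@le_trans _ _ (\int[mu]_(x in A) ((t `^ p)%:E + \sum_(k <oo) u k x))%E).
  apply: le_integral_set => [|||x|x _]; first exact: mA.
  - exact: mMp.
  - exact: emeasurable_funD (measurable_cst _) mS.
  - exact: poweR_ge0.
  - apply: (le_trans (le_dyadic_levels (ltW p1) t0 (maximal_ge0 f x))).
    by rewrite /u; under [in leRHS]eq_eseriesr do rewrite indic_setE.
rewrite ge0_integralD; last 5 first.
- exact: mA.
- by move=> x _; rewrite lee_fin powR_ge0.
- exact: measurable_cst.
- by move=> x _; exact: nneseries_ge0.
- exact: measurable_funTS mS.
rewrite (integral_cst _ mA); apply: leeD2l.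
rewrite integral_nneseries; last 3 first.
- exact: mA.
- by move=> k; exact: measurable_funTS (mu_ k).
- by move=> k x _; exact: u0.
pose h k x := (`|f x| * \1_[set x | (2 ^+ k * t / 2 < `|f x|)%R] x)%:E.
have mh k : measurable_fun setT (h k).
  apply/measurable_EFinP; apply: measurable_funM; first exact: mabs.
  apply: measurable_indic; rewrite -[X in measurable X]setTI.
  exact: measurable_fun_ltr.
have h0 k x : (0 <= h k x)%E by rewrite lee_fin mulr_ge0.
(* The height of the k-th layer times the weak-type constant at its level. *)
pose d k := (2 ^+ k.+1 * t) `^ p * (3 ^+ n * 2 / (2 ^+ k * t)).
have d0 k : 0 <= d k.
  by rewrite mulr_ge0 ?powR_ge0// divr_ge0 ?mulr_ge0 ?exprn_ge0// ltW.
have uh k : (\int[mu]_(x in A) u k x <= \int[mu]_(x in B) ((d k)%:E * h k x))%E.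
  rewrite ge0_integralZl_EFin; last 4 first.
  - exact: mA.
  - by move=> x _; rewrite lee_fin.
  - by apply/measurable_EFinP; exact: measurable_indic.
  - exact: powR_ge0.
  rewrite ge0_integralZl_EFin; last 4 first.
  - exact: mB.
  - by move=> x _; exact: h0.
  - exact: measurable_funTS (mh k).
  - exact: d0.
  rewrite integral_indic; [|exact: mA|exact: mE].
  rewrite /d EFinM -muleA lee_wpmul2l ?lee_fin ?powR_ge0// setIC.
  (* A cube with average above 2^k t has average above t, so the hypothesis at level t serves all
     levels. *)
  apply: weak_type_maximal => // a l l0 alA tI; apply: AB => //.
  apply: le_lt_trans tI; rewrite lee_fin ler_wpM2r ?exprn_ge0 ?(ltW l0)//.
  by rewrite ler_peMl ?(ltW t0)// exprn_ege1// ler1n.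
apply: (@le_trans _ _ (\sum_(k <oo) \int[mu]_(x in B) ((d k)%:E * h k x))%E).
  by apply: lee_nneseries => k *; [apply: integral_ge0 => x _; exact: u0|exact: uh].
have mdh k : measurable_fun setT (fun x => (d k)%:E * h k x)%E.
  by apply: measurable_funeM; exact: mh.
have dh0 k x : (0 <= (d k)%:E * h k x)%E by rewrite mule_ge0 ?lee_fin ?d0.
have mfp : measurable_fun setT (fun x => (`|f x| `^ p)%:E).
  by apply/measurable_EFinP; exact: (measurableT_comp (measurable_powR p) mabs).
have C0 := strong_constant_ge0 (ltW p1).
(* Sum and integral are exchanged so that the sum over levels can be bounded pointwise. *)
rewrite -integral_nneseries; last 3 first.
- exact: mB.
- by move=> k; exact: measurable_funTS (mdh k).
- by move=> k x _; exact: dh0.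
rewrite -ge0_integralZl_EFin; last 4 first.
- exact: mB.
- by move=> x _; rewrite lee_fin powR_ge0.
- exact: measurable_funTS mfp.
- exact: C0.
apply: le_integral_set => [|||x|x _]; first exact: mB.
- by apply: ge0_emeasurable_sum => k *; [exact: dh0|exact: mdh].
- exact: measurable_funeM.
- by apply: nneseries_ge0 => k *; exact: dh0.
apply: lime_le; first by apply: is_cvg_nneseries => k *; exact: dh0.
apply: nearW => N.
rewrite (eq_bigr (fun k => (d k * (`|f x| * \1_[set x | (2 ^+ k * t / 2 < `|f x|)%R] x))%:E)); last first.
  by move=> k _; rewrite EFinM.
rewrite sumEFin -EFinM lee_fin big_mkord.
have dE k : d k = 3 ^+ n * 2 * 2 `^ p * (2 ^+ k * t) `^ (p - 1).
  rewrite /d exprS -mulrA powRM ?(ltW (tk k))//.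
  rewrite -(@mulr_powRB1 _ (2 ^+ k * t) p) ?(ltW (tk k)) ?(lt_trans _ p1)//.
  by field; rewrite !gt_eqF.
(* The weak-type factor has lowered the exponent to p - 1, still positive; this is the form required
   by [sum_dyadic_le]. *)
rewrite (eq_bigr (fun k : 'I_N => 3 ^+ n * 2 * 2 `^ p * `|f x| *
  ((2 ^+ k * t) `^ (p - 1) * (2 ^+ k * t < 2 * `|f x|)%R%:R))); last first.
  move=> k _; rewrite indic_setE dE ltr_pdivrMr// [`|f x| * 2]mulrC; ring.
rewrite -mulr_sumr.
apply: (@le_trans _ _ (3 ^+ n * 2 * 2 `^ p * `|f x| *
   (2 `^ (p - 1) / (2 `^ (p - 1) - 1) * (2 * `|f x|) `^ (p - 1)))).
  apply: ler_wpM2l; first by rewrite !mulr_ge0 ?exprn_ge0 ?powR_ge0.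
  by apply: sum_dyadic_le; rewrite ?subr_gt0// mulr_ge0.
rewrite /strong_constant powRM// -(@mulr_powRB1 _ `|f x| p) ?(lt_trans _ p1)//.
rewrite le_eqVlt; apply/orP; left; apply/eqP; ring.
Qed.

End strong_type.

(** * Power weights on dyadic shells *)

Section power_functions.
Context {R : realType}.
Implicit Types (x y c D a e : R).

Lemma powR_expR x e : 0 < x -> x `^ e = expR (e * ln x).
Proof. by move=> x0; rewrite /powR gt_eqF. Qed.

Lemma expr_expR x k : 0 < x -> x ^+ k = expR (k%:R * ln x).
Proof. by move=> x0; rewrite -powR_mulrn ?(ltW x0)// powR_expR. Qed.

(** The relation between D and y is symmetric, so one inequality used twice gives both bounds; the
    exponent |a| covers both signs of a. *)
Lemma powR_comparable c D y a : 1 <= c -> 0 < D -> D / c <= y <= c * D ->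
  D `^ a / c `^ `|a| <= y `^ a <= c `^ `|a| * D `^ a.
Proof.
move=> c1 D0 /andP[Dy yD].
have c0 : 0 < c by lra.
have y0 : 0 < y by rewrite (lt_le_trans _ Dy)// divr_gt0.
have main u v : 0 < u -> 0 < v -> u <= c * v -> v <= c * u ->
    u `^ a <= c `^ `|a| * v `^ a.
  move=> u0 v0 uv vu; rewrite !powR_expR// -expRD ler_expR.
  have h1 : ln v <= ln c + ln u by rewrite -lnM ?posrE// ler_ln ?posrE ?mulr_gt0.
  have h2 : ln u <= ln c + ln v by rewrite -lnM ?posrE// ler_ln ?posrE ?mulr_gt0.
  have [a0|a0] := leP 0 a.
    rewrite ger0_norm// -mulrDr ler_wpM2l//.
  rewrite ltr0_norm//.
  have : 0 <= - a * (ln c + ln u - ln v) by rewrite mulr_ge0 ?subr_ge0// ltW; lra.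
  lra.
have yD' : D <= c * y by rewrite -ler_pdivrMl// mulrC.
by rewrite main// andbT ler_pdivrMr ?powR_gt0// mulrC main.
Qed.

Lemma powR_nonincreasing x y e : e <= 0 -> 0 < x -> x <= y -> y `^ e <= x `^ e.
Proof.
move=> e0 x0 xy; have y0 := lt_le_trans x0 xy.
by rewrite !powR_expR// ler_expR ler_wnM2l// ler_ln.
Qed.

Lemma sum_geometric_le (q : R) N : 0 <= q < 1 -> \sum_(k < N) q ^+ k <= (1 - q)^-1.
Proof.
move=> /andP[q0 q1]; have q1' : 0 < 1 - q by lra.
rewrite -[leRHS]div1r ler_pdivlMr//.
suff -> : (\sum_(k < N) q ^+ k) * (1 - q) = 1 - q ^+ N.
  by rewrite gerBl exprn_ge0.
elim: N => [|N IH]; first by rewrite big_ord0 expr0; ring.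
by rewrite big_ord_recr/= mulrDl IH exprS; ring.
Qed.

End power_functions.

Section shells.
Context {R : realType} {n : nat}.
Local Notation mu := (@lebesgue_Rn R n).
Hypothesis n0 : (0 < n)%N.

Definition shell (r : R) : set (Rn R n) := cball r `\` cball (r / 2).

Lemma measurable_shell r : measurable (shell r).
Proof. by apply: measurableD; exact: measurable_cball. Qed.

Lemma euclidean_norm_ge r (x : Rn R n) : 0 <= r -> ~ cball r x -> r <= euclidean_norm x.
Proof.
move=> r0 /not_cballP[i ri]; rewrite /euclidean_norm.
rewrite (le_trans (ltW ri))// -[leLHS]normr_id -sqrtr_sqr ler_wsqrtr//.
rewrite (bigD1 i)//= real_normK ?num_real// lerDl.
by apply: sumr_ge0 => j _; exact: sqr_ge0.
Qed.

Lemma euclidean_norm_le r (x : Rn R n) : 0 <= r -> cball r x ->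
  euclidean_norm x <= n%:R * r.
Proof.
move=> r0 /cballP xr; rewrite /euclidean_norm.
rewrite -[leRHS]ger0_norm ?mulr_ge0// -sqrtr_sqr ler_wsqrtr// exprMn.
apply: (@le_trans _ _ (\sum_(i < n) r ^+ 2)).
  by apply: ler_sum => i _; rewrite -real_normK ?num_real// lerXn2r ?nnegrE.
rewrite sumr_const card_ord -[leLHS]mulr_natl ler_wpM2r ?exprn_ge0//.
by rewrite -natrX ler_nat -mulnn leq_pmulr.
Qed.

(** Points with sup norm between D/4 and 4D have Euclidean norm between D/4 and 4nD, hence within a
    factor 4n of D. *)
Definition weight_constant (alpha : R) := (4 * n%:R) `^ `|alpha|.

Lemma weight_constant_ge1 alpha : 1 <= weight_constant alpha.
Proof.
rewrite -[leLHS](powRr0 (4 * n%:R)); apply: ler_powR => //.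
have : (1 : R) <= n%:R by rewrite ler1n.
by lra.
Qed.

Lemma power_weight_comparable alpha D (x : Rn R n) : 0 < D ->
  cball (4 * D) x -> ~ cball (D / 4) x ->
  D `^ alpha / weight_constant alpha <= power_weight alpha x
    <= weight_constant alpha * D `^ alpha.
Proof.
move=> D0 xD Dx; have n1 : (1 : R) <= n%:R by rewrite ler1n.
apply: powR_comparable => //; first by lra.
have D4 : 0 <= D / 4 by lra.
have D4' : 0 <= 4 * D by lra.
rewrite (le_trans _ (euclidean_norm_ge D4 Dx))/=; last first.
  by rewrite ler_pM2l// lef_pV2 ?posrE; lra.
by rewrite (le_trans (euclidean_norm_le D4' xD))//; lra.
Qed.

(** For x nonzero take the least k such that x is outside the ball of radius r/2^k. It is positive
    since x is in [cball r], and x lies in the shell of index k - 1. *)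
Lemma bigcup_shell r : 0 < r ->
  cball r `\` [set diag 0] = \bigcup_k shell (r / 2 ^+ k).
Proof.
move=> r0; have rk k : 0 < r / 2 ^+ k by rewrite divr_gt0 ?exprn_gt0.
have rS k : r / 2 ^+ k / 2 = r / 2 ^+ k.+1.
  by rewrite exprSr invfM mulrA.
apply/seteqP; split => [x [xr x0]|x [k _ [xk xk']]]; last first.
  split; first by apply: le_cball xk; rewrite ler_pdivrMr ?exprn_gt0// ler_peMr ?(ltW r0)// exprn_ege1// ler1n.
  move=> x0; apply: xk'; rewrite x0; apply/cballP => i.
  by rewrite tnth_diag normr0 rS ltW.
have ex : exists k, `[< ~ cball (r / 2 ^+ k) x >].
  have [i xi] : exists i, tnth x i != 0.
    apply: contrapT => h; apply: x0; apply: eq_from_tnth => i.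
    by rewrite tnth_diag; apply/eqP; apply: contrapT => /negP hi; apply: h; exists i.
  have xi0 : 0 < `|tnth x i| by rewrite normr_gt0.
  exists (Num.truncn (r / `|tnth x i|)).+1; apply/asboolP/not_cballP; exists i.
  rewrite ltr_pdivrMr ?exprn_gt0// mulrC -ltr_pdivrMr//.
  rewrite (lt_trans (truncnS_gt _))// -natrX ltr_nat; exact: ltn_expl.
case: (ex_minnP ex) => -[|k] /asboolP kx kmin; first by rewrite expr0 divr1 in kx.
exists k => //; split; last by rewrite rS.
by apply: contrapT => /asboolP/kmin; rewrite ltnn.
Qed.

Lemma trivIset_shell r : 0 < r -> trivIset setT (fun k => shell (r / 2 ^+ k)).
Proof.
move=> r0; apply/trivIsetP.
suff h j k : (j < k)%N -> shell (r / 2 ^+ j) `&` shell (r / 2 ^+ k) = set0.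
  move=> j k _ _; rewrite neq_ltn => /orP[/h//|/h]; by rewrite setIC.
move=> jk; apply/seteqP; split => // x [[_ xj] [xk _]]; apply: xj.
apply: le_cball xk; rewrite -mulrA -invfM -exprSr ler_pM2l// lef_pV2 ?posrE ?exprn_gt0//.
by rewrite ler_weXn2l// ler1n.
Qed.

(** The origin is negligible as n > 0, and the bounds on the shells of radius r/2^k form a geometric
    series of ratio 2^(-gamma) < 1. *)
Lemma integral_cball_shells (g : Rn R n -> \bar R) (K gamma r : R) :
  measurable_fun setT g -> (forall x, 0 <= g x)%E ->
  0 < r -> 0 <= K -> 0 < gamma ->
  (forall s, 0 < s -> s <= r ->
    (\int[mu]_(x in shell s) g x <= (K * s `^ gamma)%:E)%E) ->
  (\int[mu]_(x in cball r) g x <= (K * (1 - 2 `^ (- gamma))^-1 * r `^ gamma)%:E)%E.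
Proof.
move=> mg g0 r0 K0 gamma0 hK.
have mF k : measurable (shell (r / 2 ^+ k)) by exact: measurable_shell.
have mZ : measurable [set (diag 0 : Rn R n)].
  by rewrite -cube_set1; exact: measurable_cube.
have muZ : mu [set (diag 0 : Rn R n)] = 0%E.
  by rewrite -cube_set1 lebesgue_Rn_cube// expr0n eqn0Ngt n0.
have rk k : 0 < r / 2 ^+ k by rewrite divr_gt0 ?exprn_gt0.
rewrite (ge0_negligible_integral mZ (measurable_cball r) (measurable_funTS mg) (fun x _ => g0 x) muZ).
rewrite bigcup_shell// ge0_integral_bigcup; last 4 first.
- exact: mF.
- exact: measurable_funTS mg.
- by move=> x _; exact: g0.
- exact: trivIset_shell.
apply: lime_le; first by apply: is_cvg_nneseries => k *; apply: integral_ge0 => x _; exact: g0.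
apply: nearW => N.
apply: (@le_trans _ _ (\sum_(0 <= k < N) (K * r `^ gamma * (2 `^ (- gamma)) ^+ k)%:E)%E).
  apply: lee_sum => k _; apply: (le_trans (hK _ (rk k) _)).
    by rewrite ler_pdivrMr ?exprn_gt0// ler_peMr ?(ltW r0)// exprn_ege1// ler1n.
  rewrite lee_fin -mulrA ler_wpM2l// powRM ?(ltW r0) ?invr_ge0 ?exprn_ge0//.
  rewrite -[2 ^+ k]powR_mulrn// -powRN -!powRrM -powR_mulrn ?powR_ge0// -powRrM.
  by rewrite le_eqVlt; apply/orP; left; apply/eqP; congr (_ * _ `^ _); ring.
rewrite sumEFin lee_fin big_mkord -mulr_sumr [leRHS]mulrAC ler_wpM2l ?mulr_ge0 ?powR_ge0//.
apply: sum_geometric_le; rewrite powR_ge0/=.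
rewrite powRN invf_lt1 ?powR_gt0//.
have : (1 : R) `^ gamma < 2 `^ gamma by rewrite gt0_ltr_powR// ?nnegrE ?ltr1n.
by rewrite powR1.
Qed.

End shells.

(** * Morrey estimates for the maximal function *)

Section morrey_estimates.
Context {R : realType} {n : nat}.
Local Notation mu := (@lebesgue_Rn R n).
Variables (p lam al : R).
Hypotheses (p1 : 1 < p) (lam0 : 0 < lam) (lamn : lam < n%:R).
Hypotheses (lam_al : lam - n%:R <= al) (al_lam : al < lam + (p - 1) * n%:R).
Let w : Rn R n -> R := power_weight al.
Hypothesis mw : measurable_fun setT w.
Variables (f : Rn R n -> R) (b : R).
Hypotheses (lf : locally_integrable_Rn f) (b0 : 0 < b).
Hypothesis f_le : forall a l, 0 < l ->
  (\int[mu]_(x in cube a l) (`|f x| `^ p * w x)%:E <= (b `^ p * l `^ lam)%:E)%E.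

Let K : R := @weight_constant R n al.
(** The growth exponent of the integral of |f| over balls around the origin; it is positive
    precisely when alpha < lambda + (p-1)n. *)
Let gamma := n%:R + (lam - al - n%:R) / p.
(** The size which the Morrey bound predicts for the average of |f| over a cube of side l at
    distance about D from the origin. *)
Let sigma D l := b * D `^ (- al / p) * l `^ ((lam - n%:R) / p).

Let n0 : (0 < n)%N.
Proof. by rewrite -(ltr0n R) (lt_trans lam0). Qed.

Let p0 : 0 < p. Proof. by rewrite (lt_trans _ p1). Qed.

Let K1 : 1 <= K. Proof. exact: weight_constant_ge1. Qed.

Let gamma0 : 0 < gamma.
Proof.
have -> : gamma = (lam + (p - 1) * n%:R - al) / p.
  by rewrite /gamma; field; rewrite gt_eqF.
by rewrite divr_gt0// subr_gt0.
Qed.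

Let sigma_gt0 D l : 0 < D -> 0 < l -> 0 < sigma D l.
Proof. by move=> D0 l0; rewrite !mulr_gt0 ?powR_gt0. Qed.

Let sigma_powR D l : 0 < D -> 0 < l ->
  sigma D l `^ p = b `^ p * D `^ (- al) * l `^ (lam - n%:R).
Proof.
move=> D0 l0; rewrite /sigma !powRM ?mulr_ge0 ?powR_ge0 ?(ltW b0)//.
by rewrite -!powRrM !divfK ?gt_eqF.
Qed.

Let mf : measurable_fun setT f := lf.1.

Let mnormf : measurable_fun setT (fun x => `|f x|).
Proof. exact: measurableT_comp. Qed.

Let mfp : measurable_fun setT (fun x => `|f x| `^ p).
Proof. exact: (measurableT_comp (measurable_powR p) mnormf). Qed.

Let w_ge0 x : 0 <= w x. Proof. exact: powR_ge0. Qed.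

(** On this annulus the weight is at least D^alpha / K, so it can be removed from the Morrey
    bound. *)
Lemma integral_powR_shell_le S a l D : measurable S -> 0 < D -> 0 < l ->
  S `<=` cube a l -> S `<=` cball (4 * D) `\` cball (D / 4) ->
  (\int[mu]_(x in S) (`|f x| `^ p)%:E <=
     (K * D `^ (- al) * (b `^ p * l `^ lam))%:E)%E.
Proof.
move=> mS D0 l0 Sal SD.
have c0 : 0 <= K * D `^ (- al) by rewrite mulr_ge0 ?powR_ge0// (le_trans _ K1).
have mfpw : measurable_fun setT (fun x => (`|f x| `^ p * w x)%:E).
  apply/measurable_EFinP; exact: measurable_funM mfp mw.
have fpw0 x : (0 <= (`|f x| `^ p * w x)%:E)%E by rewrite lee_fin mulr_ge0 ?powR_ge0.
apply: (@le_trans _ _ (\int[mu]_(x in S) ((K * D `^ (- al))%:E * (`|f x| `^ p * w x)%:E))%E).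
  apply: le_integral_set => [|||x|x Sx]; first exact: mS.
  - exact/measurable_EFinP.
  - exact: measurable_funeM mfpw.
  - by rewrite lee_fin powR_ge0.
  - have [xD /= Dx] := SD _ Sx.
    have /andP[+ _] := power_weight_comparable n0 al D0 xD Dx.
    rewrite -/(w x) -/K -EFinM lee_fin => wx.
    rewrite mulrCA ler_peMr ?powR_ge0// powRN mulrAC ler_pdivlMr ?powR_gt0//.
    by rewrite mul1r mulrC -ler_pdivrMr// (lt_le_trans ltr01 K1).
rewrite ge0_integralZl_EFin; last 4 first.
- exact: mS.
- by move=> x _; exact: fpw0.
- exact: measurable_funTS mfpw.
- exact: c0.
rewrite [leRHS]EFinM lee_wpmul2l ?lee_fin//; apply: le_trans (f_le a l0).
by apply: subset_integral_set => //; exact: measurable_cube.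
Qed.

(* Young's inequality [|f| <= s + s^(1-p) |f|^p] plays the role of Hoelder's. *)
Lemma integral_norm_le S a l s : measurable S -> 0 < s -> 0 < l -> S `<=` cube a l ->
  (\int[mu]_(x in S) `|f x|%:E <=
    (s * l ^+ n)%:E + (s `^ (1 - p))%:E * \int[mu]_(x in S) (`|f x| `^ p)%:E)%E.
Proof.
move=> mS s0 l0 Sal.
have mg : measurable_fun setT (fun x => (s `^ (1 - p))%:E * (`|f x| `^ p)%:E)%E.
  by apply: measurable_funeM; exact/measurable_EFinP.
apply: (@le_trans _ _ (\int[mu]_(x in S) (s%:E + (s `^ (1 - p))%:E * (`|f x| `^ p)%:E))%E).
  apply: le_integral_set => [|||x|x Sx]; first exact: mS.
  - exact/measurable_EFinP.
  - exact: emeasurable_funD (measurable_cst _) mg.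
  - by rewrite lee_fin.
  - rewrite -EFinM -EFinD lee_fin.
    have [fs|sf] := leP (`|f x|) s.
      by rewrite (le_trans fs)// lerDl mulr_ge0 ?powR_ge0.
    rewrite ler_wpDl ?(ltW s0)//.
    have f0 : 0 < `|f x| by rewrite (lt_trans s0).
    have -> : s `^ (1 - p) = (s `^ (p - 1))^-1 by rewrite -powRN opprB.
    rewrite mulrC ler_pdivlMr ?powR_gt0// -(@mulr_powRB1 _ `|f x| p)//.
    by rewrite ler_wpM2l// ge0_ler_powR ?nnegrE ?subr_ge0 ?(ltW p1) ?(ltW s0) ?(ltW sf).
rewrite ge0_integralD; last 5 first.
- exact: mS.
- by move=> x _; rewrite lee_fin ltW.
- exact: measurable_cst.
- by move=> x _; rewrite -EFinM lee_fin mulr_ge0 ?powR_ge0.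
- exact: measurable_funTS mg.
rewrite ge0_integralZl_EFin; last 4 first.
- exact: mS.
- by move=> x _; rewrite lee_fin powR_ge0.
- by apply/measurable_EFinP; exact: measurable_funTS mfp.
- exact: powR_ge0.
apply: leeD => //; rewrite -(@integral_cst_cube _ _ a) ?(ltW l0)//.
apply: (subset_integral_set mS (measurable_cube a l) (measurable_cst _)) => // x.
by rewrite lee_fin ltW.
Qed.

(** Young's inequality with s = [sigma D l], the value that balances its two terms: the unweighted
    bound on |f|^p is exactly K s^p l^n. *)
Lemma integral_norm_shell_le S a l D : measurable S -> 0 < D -> 0 < l ->
  S `<=` cube a l -> S `<=` cball (4 * D) `\` cball (D / 4) ->
  (\int[mu]_(x in S) `|f x|%:E <= ((1 + K) * sigma D l * l ^+ n)%:E)%E.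
Proof.
move=> mS D0 l0 Sal SD; have s0 := sigma_gt0 D0 l0.
apply: (le_trans (integral_norm_le mS s0 l0 Sal)).
apply: (@le_trans _ _ ((sigma D l * l ^+ n)%:E + (sigma D l `^ (1 - p))%:E *
   (K * D `^ (- al) * (b `^ p * l `^ lam))%:E)%E).
  apply: leeD2l; apply: lee_wpmul2l; first by rewrite lee_fin powR_ge0.
  exact: integral_powR_shell_le mS D0 l0 Sal SD.
rewrite -EFinM -EFinD lee_fin.
have -> : K * D `^ (- al) * (b `^ p * l `^ lam) = K * sigma D l `^ p * l ^+ n.
  rewrite sigma_powR//.
  have -> : l `^ lam = l `^ (lam - n%:R) * l ^+ n.
    rewrite -powR_mulrn ?(ltW l0)// -powRD ?subrK//.
    by rewrite (gt_eqF l0) implybT.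
  by ring.
have E : sigma D l `^ (1 - p) * sigma D l `^ p = sigma D l.
  by rewrite -powRD ?subrK ?powRr1 ?(ltW s0)// (gt_eqF s0) implybT.
rewrite le_eqVlt; apply/orP; left; apply/eqP.
transitivity (sigma D l * l ^+ n + K * (sigma D l `^ (1 - p) * sigma D l `^ p) * l ^+ n).
  by ring.
by rewrite E; ring.
Qed.

Let C1 := (1 + K) * 2 ^+ n * (1 - 2 `^ (- gamma))^-1.

(** The shell of radius s lies in a cube of side 2s and contributes O(s^gamma); the sum over shells
    converges since [gamma] is positive. *)
Lemma integral_norm_cball_le r : 0 < r ->
  (\int[mu]_(x in cball r) `|f x|%:E <= (C1 * b * r `^ gamma)%:E)%E.
Proof.
move=> r0; have K10 : 0 <= 1 + K by rewrite addr_ge0// (le_trans _ K1).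
have -> : C1 * b = ((1 + K) * 2 ^+ n * b) * (1 - 2 `^ (- gamma))^-1.
  by rewrite /C1; ring.
apply: integral_cball_shells; first exact: n0.
- exact/measurable_EFinP.
- by move=> x; rewrite lee_fin.
- exact: r0.
- by rewrite !mulr_ge0 ?exprn_ge0// ltW.
- exact: gamma0.
move=> s s0 sr; have s20 : 0 < 2 * s by rewrite mulr_gt0.
have Ss : shell s `<=` (cball (4 * s) `\` cball (s / 4) : set (Rn R n)).
  have s4 : s <= 4 * s by lra.
  move=> x [xs xs']; split; first exact: (le_cball s4 xs).
  have s42 : s / 4 <= s / 2 by lra.
  by move=> /(le_cball s42).
apply: (le_trans (integral_norm_shell_le (measurable_shell _) s0 s20 _ Ss)).
  by move=> x [xs _]; exact: xs.
have -> : (1 + K) * sigma s (2 * s) * (2 * s) ^+ n =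
    (1 + K) * 2 ^+ n * b * s `^ gamma * 2 `^ ((lam - n%:R) / p).
  have -> : s `^ gamma = s `^ (- al / p) * s `^ ((lam - n%:R) / p) * s ^+ n.
    rewrite !powR_expR// expr_expR// -!expRD; congr expR.
    by rewrite /gamma; field; rewrite gt_eqF.
  by rewrite /sigma powRM ?(ltW s0)// exprMn; ring.
rewrite lee_fin ler_piMr ?mulr_ge0 ?powR_ge0 ?exprn_ge0 ?(ltW b0)//.
rewrite -[leRHS](powRr0 2) ler_powR ?ler1n//.
by rewrite pmulr_lle0 ?invr_gt0// subr_le0 ltW.
Qed.

Let C1_ge0 : 0 <= C1.
Proof.
have q1 : (2 : R) `^ (- gamma) <= 1.
  by rewrite -[leRHS](powRr0 2) ler_powR ?ler1n// oppr_le0 ltW.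
by rewrite /C1 !mulr_ge0 ?exprn_ge0 ?addr_ge0 ?(le_trans ler01 K1)// invr_ge0 subr_ge0.
Qed.

(** The sum of the constants for small and for large cubes in the next lemma, so that the level
    [tau] serves both. *)
Let C2 := (1 + K) + C1 * 17 `^ gamma * 8 `^ ((al + n%:R - lam) / p).
Let tau D s := C2 * sigma D s.

Let C2_gt0 : 0 < C2.
Proof.
have : 0 <= C1 * 17 `^ gamma * 8 `^ ((al + n%:R - lam) / p).
  exact: mulr_ge0 (mulr_ge0 C1_ge0 (powR_ge0 _ _)) (powR_ge0 _ _).
by have := K1; rewrite /C2; lra.
Qed.

(* A large cube close to the origin is estimated through a ball around the
   origin; a large cube far from it sees an almost constant weight. *)
Lemma integral_norm_cube_le a L D s x : 0 < s -> 8 * s <= D -> s <= L ->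
  cube a L x -> cball (2 * D) x -> ~ cball (D / 2) x ->
  (\int[mu]_(y in cube a L) `|f y|%:E <= (tau D s * L ^+ n)%:E)%E.
Proof.
move=> s0 sD sL xa xD Dx.
have D0 : 0 < D by lra.
have L0 : 0 < L by lra.
have ln0 : (lam - n%:R) / p <= 0.
  by rewrite pmulr_lle0 ?invr_gt0// subr_le0 ltW.
have C12 : 0 <= C1 * 17 `^ gamma * 8 `^ ((al + n%:R - lam) / p).
  exact: mulr_ge0 (mulr_ge0 C1_ge0 (powR_ge0 _ _)) (powR_ge0 _ _).
(* A cube of side at most D/8 through x stays where D/4 < |y| <= 4D. *)
have [LD|DL] := leP L (D / 8).
  apply: (le_trans (integral_norm_shell_le (measurable_cube _ _) D0 L0 (fun _ h => h) _)).
    move=> y ya; split.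
      apply/cballP => i; have /cballP/(_ i) := xD; have := cube_dist i xa ya.
      have := ler_normB (tnth y i - tnth x i) (- tnth x i).
      by rewrite normrN opprK subrK distrC; lra.
    move/cballP => yD; have /not_cballP[i] := Dx; have := yD i; have := cube_dist i xa ya.
    have := ler_normD (tnth x i - tnth y i) (tnth y i).
    by rewrite subrK; lra.
  rewrite lee_fin ler_wpM2r ?exprn_ge0 ?(ltW L0)// /tau.
  apply: ler_pM; rewrite ?addr_ge0 ?(le_trans ler01 K1) ?(ltW (sigma_gt0 _ _))//.
    by rewrite /C2 lerDl.
  rewrite /sigma ler_wpM2l ?mulr_ge0 ?powR_ge0 ?(ltW b0)//.
  exact: powR_nonincreasing.
(* Now D < 8L, so points of the cube satisfy |y| <= 2D + L < 17L. *)
have L17 : 0 < 17 * L by rewrite mulr_gt0.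
apply: (@le_trans _ _ (\int[mu]_(y in cball (17 * L)) `|f y|%:E)%E).
  apply: (subset_integral_set (measurable_cube a L) (measurable_cball (17 * L))).
  - exact/measurable_EFinP.
  - by move=> y; rewrite lee_fin.
  - move=> y ya; apply/cballP => i; have /cballP/(_ i) := xD; have := cube_dist i xa ya.
    have := ler_normB (tnth y i - tnth x i) (- tnth x i).
    by rewrite normrN opprK subrK distrC; lra.
apply: (le_trans (integral_norm_cball_le L17)).
rewrite lee_fin; pose e := (lam - al - n%:R) / p.
(* This sign is the assumption lambda - n <= alpha; with it, L > D/8 gives L^e <= (D/8)^e, and the
   power (lambda-n)/p of D is then traded for that of s <= D. *)
have e0 : e <= 0 by rewrite pmulr_lle0 ?invr_gt0// addrAC subr_le0.
have -> : (17 * L) `^ gamma = 17 `^ gamma * (L `^ e * L ^+ n).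
  rewrite powRM ?(ltW L0)//; congr (_ * _).
  rewrite !powR_expR// expr_expR// -expRD; congr expR.
  by rewrite /gamma /e; ring.
have Le : L `^ e <= 8 `^ ((al + n%:R - lam) / p) * (D `^ (- al / p) * s `^ ((lam - n%:R) / p)).
  have D8 : 0 < D / 8 by rewrite divr_gt0.
  apply: (le_trans (powR_nonincreasing e0 D8 (ltW DL))).
  have -> : (D / 8) `^ e = 8 `^ ((al + n%:R - lam) / p) *
      (D `^ (- al / p) * D `^ ((lam - n%:R) / p)).
    rewrite powRM ?invr_ge0 ?(ltW D0)// -powRD ?(gt_eqF D0) ?implybT//.
    rewrite -[8^-1]powR_inv1// -powRrM mulrC; congr (_ `^ _ * _ `^ _).
      by rewrite /e; field; rewrite gt_eqF.
    by rewrite /e; field; rewrite gt_eqF.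
  rewrite ler_wpM2l ?powR_ge0// ler_wpM2l ?powR_ge0//.
  by apply: powR_nonincreasing => //; lra.
apply: (@le_trans _ _ (C1 * 17 `^ gamma * 8 `^ ((al + n%:R - lam) / p) * sigma D s * L ^+ n)).
  have -> : C1 * b * (17 `^ gamma * (L `^ e * L ^+ n)) =
      C1 * 17 `^ gamma * b * L ^+ n * L `^ e by ring.
  apply: (le_trans (ler_wpM2l _ Le)).
    exact: mulr_ge0 (mulr_ge0 (mulr_ge0 C1_ge0 (powR_ge0 _ _)) (ltW b0)) (exprn_ge0 _ (ltW L0)).
  by rewrite le_eqVlt /sigma; apply/orP; left; apply/eqP; ring.
rewrite ler_wpM2r ?exprn_ge0 ?(ltW L0)// /tau ler_wpM2r ?(ltW (sigma_gt0 _ _))//.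
by rewrite /C2 lerDr addr_ge0 ?(le_trans ler01 K1).
Qed.

Let SC := @strong_constant R n p.
Let C4 := K * (C2 `^ p * 32 ^+ n + SC * K * 32 `^ lam).

(** The weight is about D^alpha on [A], and the strong-type bound started at level [tau D s] yields
    two terms, both of size b^p s^lambda D^(-alpha). The factor 32 suits both uses: whole shells
    with s = D/8, and single cubes of side s. *)
Lemma integral_maximal_region_le (A : set (Rn R n)) v D s : measurable A ->
  0 < s -> 8 * s <= D -> A `<=` cball (2 * D) `\` cball (D / 2) ->
  (forall a l x, 0 < l -> l <= s -> cube a l x -> A x ->
     cube a l `<=` cube v (32 * s)) ->
  (\int[mu]_(x in A) (maximal f x `^ p * (w x)%:E) <=
    (C4 * b `^ p * s `^ lam)%:E)%E.
Proof.
move=> mA s0 sD AD Av; have D0 : 0 < D by lra.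
have s320 : 0 < 32 * s by rewrite mulr_gt0.
pose B := cube v (32 * s) `&` (cball (4 * D) `\` cball (D / 4)).
have mB : measurable B.
  apply: measurableI; first exact: measurable_cube.
  by apply: measurableD; exact: measurable_cball.
have t0 : 0 < tau D s by rewrite mulr_gt0// sigma_gt0.
have mM := measurable_maximal lf.
have mMp : measurable_fun setT (fun x => maximal f x `^ p)%E.
  exact: (measurableT_comp (measurable_poweR p) mM).
(* Cubes of side at least s have average at most [tau D s]; those above the level are therefore
   shorter and stay in [B]. *)
have AB a l : 0 < l -> cube a l `&` A !=set0 ->
    ((tau D s * l ^+ n)%:E < \int[mu]_(y in cube a l) `|f y|%:E)%E ->
    cube a l `<=` B.
  move=> l0 [x [xa Ax]]; have [xD Dx] := AD _ Ax.
  have [sl|ls _] := leP s l.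
    by move=> /(le_lt_trans (integral_norm_cube_le s0 sD sl xa xD Dx)); rewrite ltxx.
  move=> y ya; split; first exact: Av (ltW ls) xa Ax _ ya.
  split.
    apply/cballP => i; have /cballP/(_ i) := xD; have := cube_dist i xa ya.
    have := ler_normB (tnth y i - tnth x i) (- tnth x i).
    by rewrite normrN opprK subrK distrC; lra.
  move/cballP => yD; have /not_cballP[i] := Dx; have := yD i; have := cube_dist i xa ya.
  have := ler_normD (tnth x i - tnth y i) (tnth y i).
  by rewrite subrK; lra.
have KD0 : 0 <= K * D `^ al by rewrite mulr_ge0 ?powR_ge0// (le_trans _ K1).
apply: (@le_trans _ _ (\int[mu]_(x in A) ((K * D `^ al)%:E * maximal f x `^ p))%E).
  apply: le_integral_set => [|||x|x Ax]; first exact: mA.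
  - have mwE : measurable_fun setT (fun x => (w x)%:E) by exact/measurable_EFinP.
    exact: emeasurable_funM mMp mwE.
  - exact: measurable_funeM mMp.
  - by rewrite mule_ge0 ?poweR_ge0// lee_fin.
  - rewrite muleC lee_wpmul2r ?poweR_ge0// lee_fin.
    have [xD Dx] := AD _ Ax.
    have D24 : 2 * D <= 4 * D by lra.
    have D42 : D / 4 <= D / 2 by lra.
    have xD4 := le_cball D24 xD.
    have Dx4 : ~ cball (D / 4) x by move=> /(le_cball D42).
    by have /andP[] := power_weight_comparable n0 al D0 xD4 Dx4.
rewrite ge0_integralZl_EFin; last 4 first.
- exact: mA.
- by move=> x _; exact: poweR_ge0.
- exact: measurable_funTS mMp.
- exact: KD0.
(* [A] lies in the cube at [v]: the containment hypothesis is applied, for each x in [A], to the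
   cube of side s with corner x. *)
have muA : (mu A <= ((32 * s) ^+ n)%:E)%E.
  rewrite -(lebesgue_Rn_cube v) ?(ltW s320)//.
  apply: le_measure; rewrite ?inE//; first exact: measurable_cube.
  by move=> x Ax; apply: (Av x s x) => //; exact/cube_refl/ltW.
have SC0 : 0 <= SC by exact: strong_constant_ge0 (ltW p1).
have fB := integral_powR_shell_le mB D0 s320 (@subIsetl _ _ _) (@subIsetr _ _ _).
apply: (@le_trans _ _ ((K * D `^ al)%:E * ((tau D s `^ p)%:E * ((32 * s) ^+ n)%:E +
    SC%:E * (K * D `^ (- al) * (b `^ p * (32 * s) `^ lam))%:E))%E).
  rewrite lee_wpmul2l ?lee_fin//; apply: (le_trans (strong_type_maximal lf p1 t0 mA mB AB)).
  by apply: leeD; rewrite lee_wpmul2l ?lee_fin ?powR_ge0.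
rewrite -(EFinM (tau D s `^ p)) -(EFinM SC) -EFinD -EFinM lee_fin.
rewrite le_eqVlt; apply/orP; left; apply/eqP.
rewrite /tau powRM ?(ltW C2_gt0) ?(ltW (sigma_gt0 _ _))// sigma_powR//.
rewrite exprMn (powRM _ _ (ltW s0))// powRB ?(gt_eqF s0) ?implybT//.
rewrite powR_mulrn ?(ltW s0)// powRN /C4; field.
by rewrite !gt_eqF ?exprn_gt0 ?powR_gt0.
Qed.

Let C5 := C4 + C4 * (1 - 2 `^ (- lam))^-1 * 9 `^ lam.

Let C4_ge0 : 0 <= C4.
Proof.
have SC0 : 0 <= SC by exact: strong_constant_ge0 (ltW p1).
have K0 := le_trans ler01 K1.
apply: (mulr_ge0 K0); apply: addr_ge0; last exact: mulr_ge0 (mulr_ge0 SC0 K0) (powR_ge0 _ _).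
by apply: mulr_ge0; rewrite ?powR_ge0// exprn_ge0.
Qed.

Let maximal_weight_ge0 x : (0 <= maximal f x `^ p * (w x)%:E)%E.
Proof. by rewrite mule_ge0 ?poweR_ge0// lee_fin. Qed.

Let measurable_maximal_weight :
  measurable_fun setT (fun x => maximal f x `^ p * (w x)%:E)%E.
Proof.
have mwE : measurable_fun setT (fun x => (w x)%:E) by exact/measurable_EFinP.
have mM := measurableT_comp (measurable_poweR p) (measurable_maximal lf).
exact: emeasurable_funM mM mwE.
Qed.

(** Each shell of radius s is a region with D = s and scale s/8, contained in the cube of side
    32(s/8) = 4s centred at the origin; the shells sum geometrically as lambda > 0. *)
Lemma integral_maximal_cball_le r : 0 < r ->
  (\int[mu]_(x in cball r) (maximal f x `^ p * (w x)%:E) <=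
    (C4 * b `^ p * (1 - 2 `^ (- lam))^-1 * r `^ lam)%:E)%E.
Proof.
move=> r0; apply: integral_cball_shells; first exact: n0.
- exact: measurable_maximal_weight.
- exact: maximal_weight_ge0.
- exact: r0.
- exact: mulr_ge0 C4_ge0 (powR_ge0 _ _).
- exact: lam0.
move=> s s0 sr; have s80 : 0 < s / 8 by rewrite divr_gt0.
have s8s : 8 * (s / 8) <= s by lra.
have s2s : s <= 2 * s by lra.
have Ss : shell s `<=` (cball (2 * s) `\` cball (s / 2) : set (Rn R n)).
  by move=> x [xs xs']; split=> //; exact: (le_cball s2s xs).
have Sv a l x : 0 < l -> l <= s / 8 -> cube a l x -> shell s x ->
    cube a l `<=` (cube (diag (- (2 * s))) (32 * (s / 8)) : set (Rn R n)).
  move=> l0 ls xa [/cballP xs _] y ya; apply/cubeP => i; rewrite tnth_diag.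
  have := xs i; have := cube_dist i xa ya; rewrite !ler_norml; lra.
apply: le_trans (integral_maximal_region_le (measurable_shell _) s80 s8s Ss Sv) _.
rewrite lee_fin; apply: ler_wpM2l; first exact: mulr_ge0 C4_ge0 (powR_ge0 _ _).
by rewrite ge0_ler_powR ?nnegrE ?(ltW lam0) ?(ltW s0) ?(ltW s80)//; lra.
Qed.

(** If all coordinates of the corner are at most 8l in absolute value, the cube lies in the ball of
    radius 9l; otherwise it is a region with D the largest of them and scale l. *)
Lemma integral_maximal_cube_le a l : 0 < l ->
  (\int[mu]_(x in cube a l) (maximal f x `^ p * (w x)%:E) <=
    (C5 * b `^ p * l `^ lam)%:E)%E.
Proof.
move=> l0.
have q0 : 0 <= (1 - (2 : R) `^ (- lam))^-1.
  by rewrite invr_ge0 subr_ge0 -[leRHS](powRr0 2) ler_powR ?ler1n// oppr_le0 ltW.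
have [j jmax] : exists j, forall i, `|tnth a i| <= `|tnth a j|.
  case: (@Order.TotalTheory.arg_maxP _ _ _ (Ordinal n0) xpredT (fun i => `|tnth a i|)) => // j _ h.
  by exists j => i; exact: h.
have [aj|aj] := leP `|tnth a j| (8 * l).
  have l90 : 0 < 9 * l by rewrite mulr_gt0.
  apply: (@le_trans _ _ (\int[mu]_(x in cball (9 * l)) (maximal f x `^ p * (w x)%:E))%E).
    apply: (subset_integral_set (measurable_cube a l) (measurable_cball (9 * l))).
    - exact: measurable_maximal_weight.
    - exact: maximal_weight_ge0.
    move=> x xa; apply/cballP => i; have := le_trans (jmax i) aj.
    have := cube_dist i xa (cube_refl a (ltW l0)); rewrite !ler_norml; lra.
  apply: (le_trans (integral_maximal_cball_le l90)).
  rewrite lee_fin powRM ?(ltW l0)//.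
  have -> : C4 * b `^ p / (1 - 2 `^ (- lam)) * (9 `^ lam * l `^ lam) =
    C4 / (1 - 2 `^ (- lam)) * 9 `^ lam * b `^ p * l `^ lam by ring.
  by rewrite ler_wpM2r ?powR_ge0// ler_wpM2r ?powR_ge0// /C5 lerDr.
apply: (@le_trans _ _ (C4 * b `^ p * l `^ lam)%:E); last first.
  rewrite lee_fin ler_wpM2r ?powR_ge0// ler_wpM2r ?powR_ge0// /C5 lerDl.
  exact: mulr_ge0 (mulr_ge0 C4_ge0 q0) (powR_ge0 _ _).
apply: (@integral_maximal_region_le _ [tuple tnth a i - l | i < n] `|tnth a j|) => //.
- exact: measurable_cube.
- exact: ltW.
- move=> x xa; split.
    apply/cballP => i; have := jmax i.
    by have := cube_dist i xa (cube_refl a (ltW l0)); move: aj; rewrite !ler_norml; lra.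
  move/cballP/(_ j); have := cube_dist j (cube_refl a (ltW l0)) xa.
  have := ler_normD (tnth a j - tnth x j) (tnth x j); rewrite subrK; lra.
move=> c m x m0 ml xc xa y yc; apply/cubeP => i; rewrite tnth_mktuple.
have := cube_dist i yc xc; rewrite ler_norml.
by have /cubeP/(_ i) := xa; lra.
Qed.

End morrey_estimates.

(** * Morrey norm bounds as integral bounds *)

Section morrey_norm_bound.
Context {R : realType} {n : nat}.
Local Notation mu := (@lebesgue_Rn R n).

Lemma poweR_inv_le (p b : R) (y : \bar R) : 0 < p -> 0 <= b -> (0 <= y)%E ->
  (y `^ p^-1 <= b%:E)%E = (y <= (b `^ p)%:E)%E.
Proof.
move=> p0 b0 y0; have pV0 : 0 <= p^-1 by rewrite invr_ge0 ltW.
have le_poweR q (u v : \bar R) : 0 <= q -> (0 <= u)%E -> (u <= v)%E -> (u `^ q <= v `^ q)%E.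
  move=> q0 u0 uv; apply: gt0_ler_poweR => //; rewrite in_itv/= leey andbT//.
  exact: le_trans uv.
apply/idP/idP => [/(le_poweR p _ _ (ltW p0) (poweR_ge0 _ _))|/(le_poweR p^-1 _ _ pV0 y0)].
  by rewrite -poweRrM mulVf ?gt_eqF// poweRe1.
by rewrite poweR_EFin -powRrM mulfV ?gt_eqF// powRr1.
Qed.

Lemma morrey_norm_leP (p lam b : R) (w : Rn R n -> R) (g : Rn R n -> \bar R) :
  0 < p -> 0 <= b -> (forall x, 0 <= w x) ->
  (morrey_norm p lam w g <= b%:E)%E <-> forall a l, 0 < l ->
    (\int[mu]_(x in cube a l) (`|g x| `^ p * (w x)%:E) <= (b `^ p * l `^ lam)%:E)%E.
Proof.
move=> p0 b0 w0.
have term a l : 0 < l ->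
    (((l `^ lam)^-1%R%:E * \int[mu]_(x in cube a l) (`|g x| `^ p * (w x)%:E)) `^ p^-1 <= b%:E)%E =
    (\int[mu]_(x in cube a l) (`|g x| `^ p * (w x)%:E) <= (b `^ p * l `^ lam)%:E)%E.
  move=> l0; have I0 : (0 <= \int[mu]_(x in cube a l) (`|g x| `^ p * (w x)%:E))%E.
    by apply: integral_ge0 => x _; rewrite mule_ge0 ?poweR_ge0// lee_fin.
  rewrite poweR_inv_le// ?mule_ge0 ?lee_fin ?invr_ge0 ?powR_ge0//.
  by rewrite lee_pdivrMl ?powR_gt0// -EFinM mulrC.
split=> [gb a l l0|gb].
  rewrite -term//; apply: le_trans gb; apply: ereal_sup_ubound => /=.
  by exists a => //; exists l.
by apply: ge_ereal_sup => _ [a _ [l /= l0 <-]]; rewrite term// gb.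
Qed.

End morrey_norm_bound.

(** * Test functions *)

Section test_functions.
Context {R : realType} {n : nat}.
Local Notation mu := (@lebesgue_Rn R n).

Lemma integral_sum_indic (c : nat -> R) (P : nat -> set (Rn R n)) N (A : set (Rn R n)) :
  (forall k, 0 <= c k) -> (forall k, measurable (P k)) -> measurable A ->
  (\int[mu]_(x in A) (\sum_(k < N) c k * \1_(P k) x)%:E =
    \sum_(k < N) (c k)%:E * mu (P k `&` A))%E.
Proof.
move=> c0 mP mA.
have mind k : measurable_fun A (fun x => (\1_(P k) x : R)%:E).
  by apply/measurable_EFinP; exact: measurable_indic.
under eq_integral do rewrite -sumEFin.
rewrite ge0_integral_sum; last 3 first.
- exact: mA.
- by move=> k; under eq_fun do rewrite EFinM; exact: measurable_funeM.
- by move=> k x _; rewrite lee_fin mulr_ge0.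
apply: eq_bigr => k _; rewrite -integral_indic; [|exact: mA|exact: mP].
under eq_integral do rewrite EFinM.
rewrite ge0_integralZl_EFin//.
Qed.

(** By disjointness at most one term is nonzero at x. *)
Lemma powR_disjoint_sum_indic (c : nat -> R) (P : nat -> set (Rn R n)) N p x :
  1 < p -> (forall j k, (j < k)%N -> P j `&` P k = set0) ->
  (\sum_(k < N) c k * \1_(P k) x) `^ p = \sum_(k < N) c k `^ p * \1_(P k) x.
Proof.
move=> p1 disj; elim: N => [|N IH]; first by rewrite !big_ord0 powR0// gt_eqF// (lt_trans _ p1).
rewrite !big_ord_recr/= indicE; case: (boolP (x \in P N)) => [|_]; last first.
  by rewrite !mulr0 !addr0.
rewrite inE => xN; rewrite !mulr1.
have z (d : nat -> R) : \sum_(k < N) d k * \1_(P k) x = 0.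
  apply: big1 => k _; rewrite indicE memNset ?mulr0// => xk.
  suff : (P k `&` P N) x by rewrite disj.
  by [].
by rewrite (z c) (z (fun k => c k `^ p)) !add0r.
Qed.

Variables (p lam al : R).
Hypotheses (p1 : 1 < p) (lam0 : 0 < lam) (lamn : lam < n%:R).
Let w : Rn R n -> R := power_weight al.
Hypothesis mw : measurable_fun setT w.
Let K : R := @weight_constant R n al.
(** Chosen so that p beta + alpha = lambda - n: the bump at distance r then has weighted p-th power
    about r^(lambda-n), hence total mass about r^lambda. *)
Let beta := (lam - al - n%:R) / p.
Let r k : R := 2^-1 ^+ k.
(** All coordinates lie between r and 3r/2: the weight is comparable to r^alpha there, and the cubes
    of different k are disjoint. *)
Let P k : set (Rn R n) := cube (diag (r k)) (r k / 2).

Definition test_function N (x : Rn R n) : R := \sum_(k < N) r k `^ beta * \1_(P k) x.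

Let n0 : (0 < n)%N.
Proof. by rewrite -(ltr0n R) (lt_trans lam0). Qed.

Let p0 : 0 < p. Proof. by rewrite (lt_trans _ p1). Qed.

Let r0 k : 0 < r k. Proof. by rewrite exprn_gt0. Qed.

Let r1 k : r k <= 1. Proof. by rewrite exprn_ile1// invf_le1// ler1n. Qed.

Let mP k : measurable (P k). Proof. exact: measurable_cube. Qed.

Let K1 : 1 <= K. Proof. exact: weight_constant_ge1. Qed.

Let P_disj j k : (j < k)%N -> P j `&` P k = set0.
Proof.
move=> jk; apply/seteqP; split => // x [/cubeP/(_ (Ordinal n0)) xj /cubeP/(_ (Ordinal n0)) xk].
move: xj xk; rewrite !tnth_diag.
suff : r k <= r j / 2 by have := r0 j; have := r0 k; lra.
rewrite /r -exprSr; apply: ler_wiXn2l => //.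
by rewrite invf_le1// ler1n.
Qed.

Lemma measurable_test_function N : measurable_fun setT (test_function N).
Proof.
apply: measurable_sum => k.
by apply: measurable_funM; [exact: measurable_cst|exact: measurable_indic].
Qed.

Lemma test_function_ge0 N x : 0 <= test_function N x.
Proof. by apply: sumr_ge0 => k _; rewrite mulr_ge0 ?powR_ge0. Qed.

(** The volume is at most min(l, s)^n, which is split with the nonnegative exponents lambda and n -
    lambda. *)
Lemma mu_cubeI a v l s : 0 < l -> 0 < s ->
  (mu (cube v s `&` cube a l) <= (l `^ lam * s `^ (n%:R - lam))%:E)%E.
Proof.
move=> l0 s0; have nl : 0 <= n%:R - lam by rewrite subr_ge0 ltW.
have mI : measurable (cube v s `&` cube a l) by apply: measurableI; exact: measurable_cube.
have splitE (u : R) : 0 < u -> u ^+ n = u `^ lam * u `^ (n%:R - lam).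
  move=> u0; rewrite -powRD ?(gt_eqF u0) ?implybT// addrC subrK.
  by rewrite powR_mulrn// ltW.
have [ls|sl] := leP l s.
  apply: (@le_trans _ _ (l ^+ n)%:E).
    rewrite -(lebesgue_Rn_cube a (ltW l0)); apply: le_measure; rewrite ?inE//.
    exact: measurable_cube.
  by rewrite lee_fin splitE// ler_wpM2l ?powR_ge0// ge0_ler_powR ?nnegrE ?(ltW l0) ?(ltW s0).
apply: (@le_trans _ _ (s ^+ n)%:E).
  rewrite -(lebesgue_Rn_cube v (ltW s0)); apply: le_measure; rewrite ?inE//.
  exact: measurable_cube.
by rewrite lee_fin splitE// ler_wpM2r ?powR_ge0// ge0_ler_powR ?nnegrE ?(ltW l0) ?(ltW s0) ?(ltW lam0) ?(ltW sl).
Qed.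

Lemma integral_test_function N (A : set (Rn R n)) : measurable A ->
  (\int[mu]_(x in A) (test_function N x)%:E =
    \sum_(k < N) (r k `^ beta)%:E * mu (P k `&` A))%E.
Proof.
by move=> mA; apply: (integral_sum_indic N (c := fun k => r k `^ beta)) => // k; exact: powR_ge0.
Qed.

Lemma locally_integrable_test_function N : locally_integrable_Rn (test_function N).
Proof.
split; first exact: measurable_test_function.
move=> a l l0; under eq_integral do rewrite (ger0_norm (test_function_ge0 _ _)).
rewrite (integral_test_function _ (measurable_cube a l)).
apply: lte_sum_pinfty => k _; rewrite lte_mul_pinfty ?lee_fin ?powR_ge0//.
by rewrite (le_lt_trans (mu_cubeI _ _ _ _)) ?ltry// divr_gt0.
Qed.

(* The crude bound, linear in [N], is enough: the averages of [test_function N]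
   also grow linearly in [N] at the critical exponent, and [p > 1]. *)
Lemma integral_test_function_le N a l : 0 < l ->
  (\int[mu]_(x in cube a l) (`|test_function N x| `^ p * w x)%:E <=
    (K * N%:R * l `^ lam)%:E)%E.
Proof.
move=> l0; pose c k := K * r k `^ (lam - n%:R).
have c0 k : 0 <= c k by rewrite mulr_ge0 ?powR_ge0// (le_trans _ K1).
have mT := measurable_test_function N.
apply: (@le_trans _ _ (\int[mu]_(x in cube a l) (\sum_(k < N) c k * \1_(P k) x)%:E)%E).
  apply: le_integral_set => [|||x|x _]; first exact: measurable_cube.
  - apply/measurable_EFinP; apply: measurable_funM; last exact: mw.
    apply: (measurableT_comp (measurable_powR p)).
    exact: measurableT_comp mT.
  - apply/measurable_EFinP; apply: measurable_sum => k.
    by apply: measurable_funM; [exact: measurable_cst|exact: measurable_indic].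
  - by rewrite lee_fin mulr_ge0 ?powR_ge0.
  - have E : test_function N x `^ p = \sum_(k < N) (r k `^ beta) `^ p * \1_(P k) x.
      exact: (powR_disjoint_sum_indic (fun k => r k `^ beta)).
    rewrite lee_fin ger0_norm ?test_function_ge0// E.
    rewrite mulr_suml; apply: ler_sum => k _; rewrite indicE.
    case: (boolP (x \in P k)) => [|_]; last by rewrite !mulr0 mul0r.
    rewrite inE => /cubeP xP; rewrite !mulr1.
    have x1 : cball (4 * r k) x.
      apply/cballP => i; have := xP i; rewrite tnth_diag ler_norml; have := r0 k; lra.
    have x2 : ~ cball (r k / 4) x.
      move/cballP/(_ (Ordinal n0)); have := xP (Ordinal n0); rewrite tnth_diag ler_norml.
      by have := r0 k; lra.
    have /andP[_ wx] := power_weight_comparable n0 al (r0 k) x1 x2.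
    apply: (le_trans (ler_wpM2l (powR_ge0 _ _) wx)).
    rewrite mulrCA /c -/K ler_wpM2l ?(le_trans ler01 K1)//.
    rewrite -powRrM -powRD ?(gt_eqF (r0 k)) ?implybT//.
    by rewrite /beta divfK ?gt_eqF// addrAC subrK.
rewrite (integral_sum_indic _ c0 mP (measurable_cube a l)).
rewrite (_ : K * N%:R * l `^ lam = \sum_(k < N) K * l `^ lam); last first.
  by rewrite sumr_const card_ord -mulr_natr; ring.
rewrite -sumEFin; apply: lee_sum => k _.
have h : 0 < r k / 2 by rewrite divr_gt0.
apply: (@le_trans _ _ ((c k)%:E * (l `^ lam * (r k / 2) `^ (n%:R - lam))%:E)%E).
  by rewrite lee_wpmul2l ?lee_fin//; exact: mu_cubeI.
rewrite -EFinM lee_fin.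
apply: (@le_trans _ _ (c k * (l `^ lam * r k `^ (n%:R - lam)))).
  rewrite ler_wpM2l// ler_wpM2l ?powR_ge0// ge0_ler_powR ?nnegrE ?subr_ge0 ?(ltW lamn) ?(ltW h) ?(ltW (r0 k))//.
  by have := r0 k; lra.
rewrite /c.
have -> : K * r k `^ (lam - n%:R) * (l `^ lam * r k `^ (n%:R - lam)) =
  K * l `^ lam * (r k `^ (lam - n%:R) * r k `^ (n%:R - lam)) by ring.
rewrite -powRD ?(gt_eqF (r0 k)) ?implybT// (_ : lam - n%:R + (n%:R - lam) = 0); last by ring.
by rewrite powRr0 mulr1.
Qed.

(** Up to the factor 2^(-n), the integral of [test_function N]. *)
Let S N := \sum_(k < N) r k `^ (beta + n%:R).

Let S_ge0 N : 0 <= S N.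
Proof. by apply: sumr_ge0 => k _; exact: powR_ge0. Qed.

(** The cube [0, 2]^n contains x and all the bumps. One factor 2^(-n) is its inverse volume, the
    other comes from the sides r/2 of the bumps. *)
Lemma maximal_test_function_ge N x : cube (diag 0) 2 x ->
  ((4 ^- n * S N)%:E <= maximal (test_function N) x)%E.
Proof.
move=> x2; apply: (@le_trans _ _ ((mu (cube (diag 0 : Rn R n) 2))^-1 *
  (\int[mu]_(y in cube (diag 0) 2) `|test_function N y|%:E) * (\1_(cube (diag 0) 2) x)%:E)%E); last first.
  by apply: ereal_sup_ubound => /=; exists (diag 0) => //; exists 2.
rewrite indicE mem_set// mule1 lebesgue_Rn_cube// inver gt_eqF ?exprn_gt0//.
under eq_integral do rewrite (ger0_norm (test_function_ge0 _ _)).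
rewrite (integral_test_function _ (measurable_cube _ _)).
rewrite (eq_bigr (fun k : 'I_N => (2 ^- n * r k `^ (beta + n%:R))%:E)); last first.
  move=> k _; rewrite (_ : P k `&` _ = P k); last first.
    apply: setIidl => y /cubeP yP; apply/cubeP => i; have := yP i; rewrite !tnth_diag.
    by have := r0 k; have := r1 k; lra.
  rewrite lebesgue_Rn_cube ?divr_ge0 ?(ltW (r0 k))// -EFinM; congr EFin.
  rewrite powRD ?(gt_eqF (r0 k)) ?implybT// powR_mulrn ?(ltW (r0 k))//.
  by rewrite exprMn exprVn; ring.
rewrite sumEFin -EFinM lee_fin -mulr_sumr mulrA -invfM -exprMn.
by rewrite (_ : 2 * 2 = 4 :> R)//; ring.
Qed.

(* The inequality is tested on [test_function N] and the cube [0, s]^n. *)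
Lemma test_function_bound C : 0 < C ->
  (forall f : Rn R n -> R, locally_integrable_Rn f ->
    (morrey_norm p lam w (EFin \o f) < +oo)%E ->
    (morrey_norm p lam w (maximal f) <= C%:E * morrey_norm p lam w (EFin \o f))%E) ->
  forall N s, 0 < s -> s <= 2 ->
  (4 ^- n * S N) `^ p * (s `^ al / K * (s / 2) ^+ n) <= C `^ p * (K * N%:R) * s `^ lam.
Proof.
move=> C0 hC N s s0 s2.
have w0 x : 0 <= w x by exact: powR_ge0.
have K0 : 0 < K by rewrite (lt_le_trans _ K1).
pose b := (K * N%:R) `^ p^-1.
have b0 : 0 <= b by exact: powR_ge0.
have bp : b `^ p = K * N%:R.
  by rewrite -powRrM mulVf ?gt_eqF// powRr1// mulr_ge0 ?(ltW K0).
have fb : (morrey_norm p lam w (EFin \o test_function N) <= b%:E)%E.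
  apply/morrey_norm_leP => // a l l0; rewrite bp.
  by apply: le_trans (integral_test_function_le N a l0).
have foo : (morrey_norm p lam w (EFin \o test_function N) < +oo)%E.
  by rewrite (le_lt_trans fb) ?ltry.
have Mb : (morrey_norm p lam w (maximal (test_function N)) <= (C * b)%:E)%E.
  apply: (le_trans (hC _ (locally_integrable_test_function N) foo)).
  by rewrite EFinM lee_wpmul2l ?lee_fin ?(ltW C0).
have Cb0 : 0 <= C * b by rewrite mulr_ge0 ?(ltW C0).
have /(_ (diag 0) s s0) := (morrey_norm_leP lam (maximal (test_function N)) p0 Cb0 w0).1 Mb.
rewrite powRM ?(ltW C0)// bp => hM; rewrite -lee_fin; apply: le_trans hM.
(* The integral is restricted to [s/2, s]^n, away from the origin, where the weight is at least
   s^alpha / K. *)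
pose Q : set (Rn R n) := cube (diag (s / 2)) (s / 2).
have mQ : measurable Q by exact: measurable_cube.
have s20 : 0 <= s / 2 by rewrite divr_ge0// ltW.
have mM := measurable_maximal (locally_integrable_test_function N).
have mMp : measurable_fun setT (fun x => `|maximal (test_function N) x| `^ p * (w x)%:E)%E.
  apply: emeasurable_funM; last by exact/measurable_EFinP.
  apply: (measurableT_comp (measurable_poweR p)).
  exact: measurableT_comp mM.
apply: (@le_trans _ _ (\int[mu]_(x in Q) (`|maximal (test_function N) x| `^ p * (w x)%:E))%E); last first.
  apply: (subset_integral_set mQ (measurable_cube _ _) mMp).
    by move=> x; rewrite mule_ge0 ?poweR_ge0// lee_fin.
  move=> x /cubeP xQ; apply/cubeP => i; have := xQ i; rewrite !tnth_diag; lra.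
rewrite mulrA -(@integral_cst_cube _ _ (diag (s / 2)))//.
apply: (le_integral_set mQ (measurable_cst _) mMp) => x.
  by rewrite lee_fin !mulr_ge0 ?powR_ge0// invr_ge0 ltW.
move=> /cubeP xQ.
have x1 : cball (4 * s) x.
  by apply/cballP => i; have := xQ i; rewrite tnth_diag ler_norml; lra.
have x2 : ~ cball (s / 4) x.
  by move/cballP/(_ (Ordinal n0)); have := xQ (Ordinal n0); rewrite tnth_diag ler_norml; lra.
have /andP[wx _] := power_weight_comparable n0 al s0 x1 x2.
rewrite EFinM; apply: lee_pmul; rewrite ?lee_fin ?powR_ge0//.
  by rewrite divr_ge0 ?powR_ge0// ltW.
rewrite gee0_abs ?maximal_ge0// -poweR_EFin; apply: gt0_ler_poweR; first exact: ltW.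
- by rewrite in_itv/= leey lee_fin mulr_ge0// invr_ge0 exprn_ge0.
- by rewrite in_itv/= leey maximal_ge0.
- apply: maximal_test_function_ge; apply/cubeP => i; have := xQ i; rewrite !tnth_diag; lra.
Qed.

End test_functions.

(** * The norm inequality for power weights *)

Section power_weights.
Context {R : realType} {n : nat}.
Local Notation mu := (@lebesgue_Rn R n).
Variables (p lam al : R).
Hypotheses (p1 : 1 < p) (lam0 : 0 < lam) (lamn : lam < n%:R).
Let w : Rn R n -> R := power_weight al.
Hypothesis mw : measurable_fun setT w.

Let p0 : 0 < p. Proof. by rewrite (lt_trans _ p1). Qed.

Let w0 x : 0 <= w x. Proof. exact: powR_ge0. Qed.

Lemma maximal_morrey_bounded : lam - n%:R <= al -> al < lam + (p - 1) * n%:R ->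
  exists2 C : R, 0 < C & forall (f : Rn R n -> R) b, locally_integrable_Rn f -> 0 < b ->
    (morrey_norm p lam w (EFin \o f) <= b%:E)%E ->
    (morrey_norm p lam w (maximal f) <= (C * b)%:E)%E.
Proof.
move=> lam_al al_lam.
have [c hc] : exists c : R, forall (f : Rn R n -> R) b, locally_integrable_Rn f -> 0 < b ->
    (forall a l, 0 < l ->
      (\int[mu]_(x in cube a l) (`|f x| `^ p * w x)%:E <= (b `^ p * l `^ lam)%:E)%E) ->
    forall a l, 0 < l ->
      (\int[mu]_(x in cube a l) (maximal f x `^ p * (w x)%:E) <= (c * b `^ p * l `^ lam)%:E)%E.
  (* The constant is read off from the cube estimate and depends on neither f nor b. *)
  eexists => f b lf b0 fb a l l0.
  exact: (integral_maximal_cube_le p1 lam0 lamn lam_al al_lam mw lf b0 fb a l0).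
pose c1 := Num.max c 1; have c10 : 0 < c1 by rewrite lt_max ltr01 orbT.
exists (c1 `^ p^-1) => [|f b lf b0 fb]; first exact: powR_gt0.
have fb' := (morrey_norm_leP lam (EFin \o f) p0 (ltW b0) w0).1 fb.
apply/morrey_norm_leP => //; first by rewrite mulr_ge0 ?powR_ge0// ltW.
move=> a l l0; under eq_integral do rewrite (gee0_abs (maximal_ge0 _ _)).
apply: (le_trans (hc f b lf b0 fb' a l l0)).
rewrite lee_fin powRM ?powR_ge0 ?(ltW b0)// -powRrM mulVf ?gt_eqF// powRr1 ?(ltW c10)//.
by rewrite ler_wpM2r ?powR_ge0// ler_wpM2r ?powR_ge0// le_max lexx.
Qed.

(** The preceding bound requires b > 0, so it is applied with b the norm plus e/C, and e tends to 0;
    this covers a vanishing norm. *)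
Lemma maximal_morrey_le : lam - n%:R <= al -> al < lam + (p - 1) * n%:R ->
  exists2 C : R, 0 < C & forall f : Rn R n -> R, locally_integrable_Rn f ->
    (morrey_norm p lam w (EFin \o f) < +oo)%E ->
    (morrey_norm p lam w (maximal f) <= C%:E * morrey_norm p lam w (EFin \o f))%E.
Proof.
move=> lam_al al_lam; have [C C0 hC] := maximal_morrey_bounded lam_al al_lam.
exists C => // f lf foo.
have f0 : (0 <= morrey_norm p lam w (EFin \o f))%E.
  apply: (@le_trans _ _ (((1 `^ lam)^-1%R%:E *
     \int[mu]_(x in cube (diag 0) 1) (`|(EFin \o f) x| `^ p * (w x)%:E)) `^ p^-1)%E).
    exact: poweR_ge0.
  by apply: ereal_sup_ubound => /=; exists (diag 0) => //; exists 1 => //=; exact: ltr01.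
have ffin : morrey_norm p lam w (EFin \o f) \is a fin_num by rewrite ge0_fin_numE.
rewrite -(fineK ffin); set r := fine _.
have r0 : 0 <= r by exact: fine_ge0.
apply/lee_addgt0Pr => e e0.
have b0 : 0 < r + e / C by rewrite ltr_wpDl ?divr_gt0.
rewrite -EFinM -EFinD (_ : C * r + e = C * (r + e / C)); last by field; rewrite gt_eqF.
apply: hC => //; rewrite -(fineK ffin) lee_fin -/r lerDl.
by rewrite divr_ge0 ?(ltW e0) ?(ltW C0).
Qed.

(** * Necessity of the two bounds on the exponent *)

Section necessity.
Variable C : R.
Hypothesis C0 : 0 < C.
Hypothesis hC : forall f : Rn R n -> R, locally_integrable_Rn f ->
    (morrey_norm p lam w (EFin \o f) < +oo)%E ->
    (morrey_norm p lam w (maximal f) <= C%:E * morrey_norm p lam w (EFin \o f))%E.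

Let K : R := @weight_constant R n al.

Let K0 : 0 < K.
Proof.
have n0 : 0 < n%:R :> R by rewrite (lt_trans lam0).
by rewrite powR_gt0// mulr_gt0.
Qed.

(** With a single bump the test inequality bounds s^(-d) uniformly for s <= 2, which is impossible
    for d > 0. *)
Lemma exponent_ge : lam - n%:R <= al.
Proof.
rewrite leNgt; apply/negP => al_lam.
pose d := lam - n%:R - al; have d0 : 0 < d by rewrite subr_gt0.
pose A := (4 ^- n) `^ p / K / 2 ^+ n.
have A0 : 0 < A by apply: divr_gt0; [apply: divr_gt0 => //; apply: powR_gt0; rewrite invr_gt0 exprn_gt0|exact: exprn_gt0].
pose B := C `^ p * K.
have B0 : 0 < B := mulr_gt0 (powR_gt0 _ C0) K0.
have hs s : 0 < s -> s <= 2 -> s `^ (- d) <= B / A.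
  move=> s0 s2; have := test_function_bound p1 lam0 lamn mw C0 hC 1 s0 s2.
  rewrite big_ord_recl big_ord0 addr0 expr0 powR1 mulr1 -/K mulr1 -/B.
  have -> : s `^ al / K * (s / 2) ^+ n = s `^ (- d) * s `^ lam / K / 2 ^+ n.
    rewrite -powRD ?(gt_eqF s0) ?implybT// exprMn exprVn.
    rewrite (_ : - d + lam = al + n%:R); last by rewrite /d; ring.
    rewrite powRD ?(gt_eqF s0) ?implybT// powR_mulrn ?(ltW s0)//; ring.
  rewrite (_ : _ * _ = s `^ (- d) * A * s `^ lam); last by rewrite /A; ring.
  by rewrite ler_pM2r ?powR_gt0// ler_pdivlMr.
have M0 : 0 < B / A + 1 by rewrite addr_gt0// divr_gt0.
have M1 : 1 <= B / A + 1 by rewrite lerDr divr_ge0 ?(ltW A0) ?(ltW B0).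
(* This s is at most 1 and makes s^(-d) equal to B/A + 1. *)
have := hs ((B / A + 1) `^ (- d^-1)) (powR_gt0 _ M0) _.
rewrite -powRrM mulrNN mulVf ?gt_eqF// powRr1 ?(ltW M0)// => /(_ _)/wrap[].
  rewrite (@le_trans _ _ 1)//; last by rewrite ler1n.
  by rewrite -[leRHS](powRr0 (B / A + 1)) ler_powR// oppr_le0 invr_ge0 ltW.
by rewrite gerDl ler10.
Qed.

(** Otherwise the exponent beta + n is nonpositive, so every bump contributes at least 1 to the sum.
    The test inequality with s = 1 then bounds N^(p-1), although p > 1. *)
Lemma exponent_lt : al < lam + (p - 1) * n%:R.
Proof.
rewrite ltNge; apply/negP => lam_al.
pose A := (4 ^- n) `^ p * (K^-1 * 2 ^- n).
have A0 : 0 < A by apply: mulr_gt0; [apply: powR_gt0|apply: mulr_gt0]; rewrite invr_gt0 ?exprn_gt0.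
pose B := C `^ p * K.
have B0 : 0 < B := mulr_gt0 (powR_gt0 _ C0) K0.
have hN N : N.+1%:R `^ (p - 1) <= B / A :> R.
  have N0 : 0 < N.+1%:R :> R by rewrite ltr0n.
  have := test_function_bound p1 lam0 lamn mw C0 hC N.+1 ltr01 _.
  rewrite ler1n => /(_ isT); rewrite -/K !powR1 !div1r exprVn mulr1 mulrA.
  have NS : N.+1%:R <= \sum_(k < N.+1) (2^-1 ^+ k : R) `^ ((lam - al - n%:R) / p + n%:R).
    rewrite -[X in X%:R]card_ord -sumr_const; apply: ler_sum => k _.
    rewrite -[leLHS](powRr0 (2^-1 ^+ k)) ger_powR//.
      by rewrite exprn_gt0//= exprn_ile1// invf_le1// ler1n.
    have -> : (lam - al - n%:R) / p + n%:R = (lam + (p - 1) * n%:R - al) / p.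
      by field; rewrite gt_eqF.
    by rewrite pmulr_lle0 ?invr_gt0// subr_le0.
  move=> h; have : (4 ^- n * N.+1%:R) `^ p * (K^-1 * 2 ^- n) <= B * N.+1%:R.
    rewrite /B -(mulrA (C `^ p)); apply: le_trans h; rewrite -[leRHS]mulrA ler_wpM2r//.
      by rewrite mulr_ge0 ?invr_ge0 ?exprn_ge0 ?(ltW K0).
    apply: ge0_ler_powR; rewrite ?nnegrE ?(ltW p0) ?mulr_ge0 ?invr_ge0 ?exprn_ge0//.
      by apply: sumr_ge0 => k _; exact: powR_ge0.
    by rewrite ler_wpM2l// invr_ge0 exprn_ge0.
  rewrite powRM ?invr_ge0 ?exprn_ge0// -(@mulr_powRB1 _ N.+1%:R p)//.
  rewrite (_ : _ * _ * _ = N.+1%:R `^ (p - 1) * A * N.+1%:R); last by rewrite /A; ring.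
  by rewrite ler_pM2r// ler_pdivlMr.
have p10 : 0 < p - 1 by rewrite subr_gt0.
(* Any natural number above M has (p-1)-th power greater than B/A. *)
pose M := (B / A + 1) `^ (p - 1)^-1.
have M0 : 0 <= M by exact: powR_ge0.
have BA0 : 0 <= B / A + 1 by rewrite addr_ge0// divr_ge0 ?(ltW A0) ?(ltW B0).
have := hN (Num.truncn M); apply/negP; rewrite -ltNge.
apply: (@lt_le_trans _ _ (M `^ (p - 1))).
  by rewrite /M -powRrM mulVf ?gt_eqF// powRr1// ltrDl.
by rewrite ge0_ler_powR ?nnegrE ?(ltW p10)// ltW// truncnS_gt.
Qed.

End necessity.
End power_weights.

Theorem proposition4p2 (R : realType) (n : nat) (p lambda alpha : R)
    (hp : 1 < p) (hlambda0 : 0 < lambda) (hlambdan : lambda < n%:R)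
    (hw : weight (@power_weight R n alpha)) :
  (exists C : R, 0 < C /\
     forall f : Rn R n -> R,
       locally_integrable_Rn f ->
       (morrey_norm p lambda (power_weight alpha) (EFin \o f) < +oo)%E ->
       (morrey_norm p lambda (power_weight alpha) (maximal f)
          <= C%:E * morrey_norm p lambda (power_weight alpha) (EFin \o f))%E)
  <->
  lambda - n%:R <= alpha < lambda + (p - 1) * n%:R.
Proof.
have mw : measurable_fun setT (@power_weight R n alpha) by case: hw => _ [].
split=> [[C [C0 hC]]|/andP[lam_al al_lam]].
  apply/andP; split; first exact: (exponent_ge hp hlambda0 hlambdan mw C0 hC).
  exact: (exponent_lt hp hlambda0 hlambdan mw C0 hC).
have [C C0 hC] := maximal_morrey_le hp hlambda0 hlambdan mw lam_al al_lam.
by exists C.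
Qed.
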